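(* In the non-strict model, the problem of deciding, given a temporal (undirected) graph $\mathcal{G}$ and an integer $k$, whether $\mathcal{G}$ has a temporal connected component (TCC) of size at least $k$ is $\mathsf{W}[1]$-hard when parameterized by $k$.
   Context: A temporal graph $\mathcal{G}=(G,\lambda)$ with lifetime $\tau$ consists of a finite undirected graph $G$ together with a function $\lambda:E(G)\to 2^{[\tau]}$, where $[\tau]=\{1,\dots,\tau\}$; the edge $e$ is available (active) exactly at the times in $\lambda(e)$. The lifetime $\tau$ is part of the input and is not bounded. In the non-strict model, a temporal $u,v$-path is a $u,v$-path in $G$ traversing consecutive edges $e_1,\dots,e_q$ together with times $t_1\le t_2\le\dots\le t_q$ such that $t_i\in\lambda(e_i)$ for every $i$ (the trivial path from a vertex to itself is allowed). We say $u$ reaches $v$ if there is a temporal $u,v$-path. A set $X\subseteq V(G)$ is a temporal connected set if for all $u,v\in X$, $u$ reaches $v$ and $v$ reaches $u$. A TCC is an inclusion-wise maximal temporal connected set; its size is its number of vertices. *)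

(* Defs.v *)
From mathcomp Require Import all_boot.

Set Implicit Arguments.
Unset Strict Implicit.
Unset Printing Implicit Defensive.

(** * Machine model

    Structured programs over finitely many stacks of bits, one time unit per
    push, pop or test.  A stack is a one-ended Turing tape and a two-ended tape
    is a pair of stacks, so that, for a fixed program, these running times agree
    with those of multi-tape Turing machines up to a constant factor. *)

Notation word := (seq bool).

Definition store := nat -> word.

Definition upd (s : store) (x : nat) (w : word) : store :=
  fun y => if y == x then w else s y.

Inductive prog : Type :=
| Skip
| Push of nat & bool
| Pop of nat
| Seq of prog & prog
| Case of nat & prog & prog & prog
| While of nat & prog.

(** [exec p s s' t]: started in [s], the program [p] halts in [s'] after exactly
    [t] steps.  [Case x p0 pf pt] branches on whether stack [x] is empty, has
    top [false] or has top [true]; [While x p] iterates [p] until [x] is empty. *)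
Inductive exec : prog -> store -> store -> nat -> Prop :=
| ExecSkip s : exec Skip s s 1
| ExecPush x b s : exec (Push x b) s (upd s x (b :: s x)) 1
| ExecPop x s : exec (Pop x) s (upd s x (behead (s x))) 1
| ExecSeq p q s s1 s2 t1 t2 :
    exec p s s1 t1 -> exec q s1 s2 t2 -> exec (Seq p q) s s2 (t1 + t2)
| ExecCase x p0 pf pt s s' t :
    exec (if s x is b :: _ then if b then pt else pf else p0) s s' t ->
    exec (Case x p0 pf pt) s s' t.+1
| ExecWhileEnd x p s : s x = [::] -> exec (While x p) s s 1
| ExecWhileStep x p s s1 s2 t1 t2 :
    s x <> [::] -> exec p s s1 t1 -> exec (While x p) s1 s2 t2 ->
    exec (While x p) s s2 (t1 + t2).+1.

(** The pair [(w, k)] is presented with [w] on stack 0 (first letter on top) and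
    [k] in unary on stack 1. *)
Definition input (w : word) (k : nat) : store :=
  fun x => if x == 0 then w else if x == 1 then nseq k true else [::].

(** Output uses the same two stacks; the contents of the others are irrelevant. *)
Definition outputs (s : store) (w : word) (k : nat) : Prop :=
  s 0 = w /\ s 1 = nseq k true.

Definition computable (f : nat -> nat) : Prop :=
  exists p : prog, forall n : nat, exists s w t,
    exec p (input [::] n) s t /\ outputs s w (f n).

(** * Parameterized problems and reductions *)

(** An instance is an object [x : inst], presented to machines as [enc x],
    together with a parameter. *)
Record problem : Type := Problem {
  inst : Type;
  enc : inst -> word;
  yes : inst -> nat -> Prop
}.

Definition language_problem (L : word -> nat -> Prop) : problem :=
  @Problem word id L.

(** The successor in the time bound [f(k) (|x|+1)^c] only matters for the empty
    word. *)
Definition fpt_reducible (A B : problem) : Prop :=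
  exists (p : prog) (f g : nat -> nat) (c : nat),
    [/\ computable f, computable g &
      forall (x : inst A) (k : nat),
      exists (y : inst B) (k' : nat) (s : store) (t : nat),
        [/\ exec p (input (enc x) k) s t /\ outputs s (enc y) k',
            t <= f k * (size (enc x)).+1 ^ c,
            k' <= g k &
            yes x k <-> yes y k']].

(** * Words for numbers and sequences *)

Definition enc_nat (n : nat) : word := rcons (nseq n true) false.

Definition enc_seq (T : Type) (e : T -> word) (s : seq T) : word :=
  rcons (flatten [seq true :: e x | x <- s]) false.

(** * Boolean circuits and the W-hierarchy *)

Inductive gate : Type :=
| Not of nat
| And of seq nat
| Or of seq nat.

Definition preds (g : gate) : seq nat :=
  match g with Not i => [:: i] | And s | Or s => s end.

(** A circuit is a directed acyclic graph whose nodes are numbered in a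
    topological order: first the [ninputs] input nodes, then the gates. *)
Record circuit : Type := Circuit {
  ninputs : nat;
  gates : seq gate;
  outnode : nat
}.

Definition gate_wf (N : nat) (g : gate) : bool :=
  all (fun i => i < N) (preds g) &&
  match g with Not _ => true | And s | Or s => uniq s && (1 < size s) end.

Definition circuit_wf (C : circuit) : bool :=
  (outnode C < ninputs C + size (gates C)) &&
  all (fun j => gate_wf (ninputs C + j) (nth (And [::]) (gates C) j))
      (iota 0 (size (gates C))).

(** Extends the values [a] of the input nodes to the list of the values of all
    nodes; [op v g] is the value of [g] when [v] lists those of earlier nodes. *)
Definition node_values (T : Type) (op : seq T -> gate -> T) (a : seq T)
    (C : circuit) : seq T :=
  foldl (fun v g => rcons v (op v g)) a (gates C).

Definition gate_eval (v : seq bool) (g : gate) : bool :=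
  match g with
  | Not i => ~~ nth false v i
  | And s => all (nth false v) s
  | Or s => has (nth false v) s
  end.

Definition circuit_eval (C : circuit) (a : seq bool) : bool :=
  nth false (node_values gate_eval a C) (outnode C).

(** The maximal length of a path from an input node to the output node. *)
Definition depth (C : circuit) : nat :=
  nth 0 (node_values (fun v g => (\max_(i <- preds g) nth 0 v i).+1)
                     (nseq (ninputs C) 0) C) (outnode C).

(** The maximal number of large nodes, i.e. nodes of indegree greater than 2, on
    a path from an input node to the output node. *)
Definition weft (C : circuit) : nat :=
  nth 0 (node_values
           (fun v g => (2 < size (preds g)) + \max_(i <- preds g) nth 0 v i)
           (nseq (ninputs C) 0) C) (outnode C).

(** Node numbers are below the number of nodes, so writing them in unary changes
    the size of the encoding only polynomially. *)
Definition enc_gate (g : gate) : word :=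
  match g with
  | Not i => [:: false; false] ++ enc_nat i
  | And s => [:: true; false] ++ enc_seq enc_nat s
  | Or s => [:: true; true] ++ enc_seq enc_nat s
  end.

Definition enc_circuit (C : circuit) : word :=
  enc_nat (ninputs C) ++ enc_seq enc_gate (gates C) ++ enc_nat (outnode C).

Definition has_sat_of_weight (C : circuit) (k : nat) : Prop :=
  exists a : (ninputs C).-tuple bool, count id a = k /\ circuit_eval C a.

(** Weighted circuit satisfiability for circuits of weft at most [t] and depth at
    most [d]. *)
Definition WCS (t d : nat) : problem :=
  @Problem {C : circuit | [&& circuit_wf C, weft C <= t & depth C <= d]}
    (fun C => enc_circuit (val C))
    (fun C k => has_sat_of_weight (val C) k).

Definition W (t : nat) (L : word -> nat -> Prop) : Prop :=
  exists d : nat, fpt_reducible (language_problem L) (WCS t d).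

Definition W_hard (t : nat) (Q : problem) : Prop :=
  forall L : word -> nat -> Prop,
    W t L -> fpt_reducible (language_problem L) Q.

(** * Temporal graphs *)

(** The times 1, ..., tau are represented by the ordinals 0, ..., tau - 1.  The
    labelling of the edges is extended to all pairs by the empty set. *)
Record tgraph (V : finType) (tau : nat) : Type := TGraph {
  edge : rel V;
  lab : V -> V -> {set 'I_tau};
  edge_sym : symmetric edge;
  edge_irr : irreflexive edge;
  lab_sym : forall u v, lab u v = lab v u;
  lab_nonedge : forall u v, ~~ edge u v -> lab u v = set0
}.

(** The list [p] gives, for each traversed edge, its endpoint and its time. *)
Fixpoint timed_walk (V : finType) (tau : nat) (G : tgraph V tau)
    (u : V) (p : seq (V * 'I_tau)) : bool :=
  if p is (w, t) :: p' then
    [&& edge G u w, t \in lab G u w & timed_walk G w p']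
  else true.

Definition temporal_path (V : finType) (tau : nat) (G : tgraph V tau)
    (u v : V) (p : seq (V * 'I_tau)) : bool :=
  [&& timed_walk G u p,
      uniq (u :: unzip1 p),
      sorted leq [seq val t | t <- unzip2 p] &
      last u (unzip1 p) == v].

Definition reaches (V : finType) (tau : nat) (G : tgraph V tau) (u v : V) : Prop :=
  exists p, temporal_path G u v p.

Definition temporal_connected_set (V : finType) (tau : nat) (G : tgraph V tau)
    (X : {set V}) : Prop :=
  forall u v, u \in X -> v \in X -> reaches G u v /\ reaches G v u.

Definition is_TCC (V : finType) (tau : nat) (G : tgraph V tau)
    (X : {set V}) : Prop :=
  temporal_connected_set G X /\
  forall Y : {set V}, temporal_connected_set G Y -> X \subset Y -> Y = X.

Record tgraph_inst : Type := TGraphInst {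
  nvertices : nat;
  lifetime : nat;
  tg : tgraph 'I_nvertices lifetime
}.

(** Order and lifetime in unary, followed for every ordered pair of vertices by
    its adjacency bit and the characteristic vector of its set of times. *)
Definition enc_tgraph (G : tgraph_inst) : word :=
  enc_nat (nvertices G) ++ enc_nat (lifetime G) ++
  flatten [seq edge (tg G) u v ::
               [seq t \in lab (tg G) u v | t <- enum 'I_(lifetime G)]
          | u <- enum 'I_(nvertices G), v <- enum 'I_(nvertices G)].

Definition TCC_problem : problem :=
  @Problem tgraph_inst enc_tgraph
    (fun G k => exists X : {set 'I_(nvertices G)}, is_TCC (tg G) X /\ k <= #|X|).

(* Main.v *)
(** Fix [d] and let [q = 2 ^ d].  For circuits of weft 1 and depth at most [d] the
    reduction to TCC runs in polynomial time in the circuit and the unary parameter.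

    Locality: evaluate the circuit on a partial assignment with three truth values,
    where a large gate none of whose inputs is known to dominate takes its other value
    by default.  Below a large gate there are only small gates, so at most [q] inputs
    suffice to certify a dominating value, and hence there is a set [F] of at most [q]
    inputs such that every partial assignment extending that on [F] yields the true
    output.

    Cliques: an input with [k] ones is cut by them into [k + 1] blocks, and a block
    determines all the inputs in its range, zeros included.  A label is a pair [(h, v)]
    of lists of [q] claimed blocks on which the circuit evaluates to true; two labels
    are compatible if they share [h] and their claims agree.  If the circuit accepts,
    let [h] cover [F], and let [v] range over the lists of [q] of the [k + 1] blocks.
    Conversely a compatible family realizing all [(k + 1) ^ q] index lists describes an
    input, and one of its members covers [F].

    Temporal graph: subdivide every arc [p -> q] of the symmetric digraph, the first
    half being active at an early time and the second half at a late time, both in the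
    same order of the arcs.  Vertices then reach each other exactly along arcs, while
    an arc [(a, b)] reaches an arc [(c, d)] only if it comes first or [d = a]; hence a
    connected set contains at most two subdivision vertices. *)

Require Import Defs.
From mathcomp Require Import all_boot.
From mathcomp Require Import zify.
From Stdlib Require Import FunctionalExtensionality Classical.

Set Implicit Arguments.
Unset Strict Implicit.
Unset Printing Implicit Defensive.

(** * Stack programs *)

(** Labels need two lists because the default rule for large gates makes evaluation unsound on
    claims that miss [F]: one accepting label alone proves nothing. The shared list [h] gives
    completeness, since it makes a label accept whatever [v] is; soundness comes from the presence
    of every index list among the [v]. Blocks are used because an accepting input is also determined
    by its zeros, and a list of chosen ones cannot certify a zero. A block certifies each bit in its
    range, and there are only polynomially many candidates for it. Since [q] depends on [d] only,
    there are polynomially many labels, and the target size [3 * (k + 1) ^ q] depends on [k] only.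
    The factor 3 absorbs the subdivision vertices: losing two vertices cannot remove all three
    copies of an index list. Running times refer to concrete stack programs. Hence all data are
    coded as binary trees, a class of polynomial-time functions is shown to be closed under pairing,
    case analysis, equality tests and bounded iteration, and the reduction is assembled inside that
    class. *)

Lemma upd_same s x w : upd s x w x = w.
Proof. by rewrite /upd eqxx. Qed.

Lemma upd_other s x w y : y != x -> upd s x w y = s y.
Proof. by rewrite /upd => /negbTE ->. Qed.

Lemma upd_upd s x v w : upd (upd s x v) x w = upd s x w.
Proof. by apply: functional_extensionality => y; rewrite /upd; case: eqP. Qed.

Lemma upd_id s x : upd s x (s x) = s.
Proof. by apply: functional_extensionality => y; rewrite /upd; case: eqP => // ->. Qed.

Definition runs (p : prog) (s s' : store) (T : nat) : Prop :=
  exists2 t, exec p s s' t & t <= T.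

Lemma runs_le p s s' T T' : runs p s s' T -> T <= T' -> runs p s s' T'.
Proof. by case=> t ? le1 le2; exists t => //; apply: leq_trans le2. Qed.

Lemma runs_skip s : runs Skip s s 1.
Proof. by exists 1 => //; constructor. Qed.

Lemma runs_push x b s : runs (Push x b) s (upd s x (b :: s x)) 1.
Proof. by exists 1 => //; constructor. Qed.

Lemma runs_pop x s : runs (Pop x) s (upd s x (behead (s x))) 1.
Proof. by exists 1 => //; constructor. Qed.

Lemma runs_seq p q s s1 s2 T1 T2 :
  runs p s s1 T1 -> runs q s1 s2 T2 -> runs (Seq p q) s s2 (T1 + T2).
Proof.
case=> t1 e1 l1 [t2 e2 l2]; exists (t1 + t2); last exact: leq_add.
exact: ExecSeq e1 e2.
Qed.

Lemma runs_case x p0 pf pt s s' T :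
  runs (if s x is b :: _ then if b then pt else pf else p0) s s' T ->
  runs (Case x p0 pf pt) s s' T.+1.
Proof. by case=> t e l; exists t.+1 => //; constructor. Qed.

Lemma runs_while_end x p s : s x = [::] -> runs (While x p) s s 1.
Proof. by exists 1 => //; constructor. Qed.

Lemma runs_while_step x p s s1 s2 T1 T2 :
  s x <> [::] -> runs p s s1 T1 -> runs (While x p) s1 s2 T2 ->
  runs (While x p) s s2 (T1 + T2).+1.
Proof.
move=> ne [t1 e1 l1] [t2 e2 l2]; exists (t1 + t2).+1; last by rewrite ltnS leq_add.
exact: ExecWhileStep e1 e2.
Qed.

(** One step pushes at most one letter. Time bounds therefore bound output sizes, which is what lets
    polynomial bounds compose. *)
Lemma exec_growth p s s' t : exec p s s' t -> forall x, size (s' x) <= size (s x) + t.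
Proof.
elim=> {p s s' t} //=.
- by move=> s x; rewrite leq_addr.
- by move=> x b s y; rewrite /upd; case: eqP => [->|_] /=; lia.
- by move=> x s y; rewrite /upd; case: eqP => [->|_] /=; rewrite ?size_behead; lia.
- by move=> p q s s1 s2 t1 t2 _ IH1 _ IH2 x; have := IH1 x; have := IH2 x; lia.
- by move=> x p0 pf pt s s' t _ IH y; have := IH y; lia.
- by move=> x p s _ y; lia.
- move=> x p s s1 s2 t1 t2 _ _ IH1 _ IH2 y; have := IH1 y; have := IH2 y; lia.
Qed.

Lemma runs_growth p s s' T x : runs p s s' T -> size (s' x) <= size (s x) + T.
Proof. by case=> t /exec_growth/(_ x) g l; lia. Qed.

(** * Relocation of programs and the stacks they touch *)

Fixpoint shift (b : nat) (p : prog) : prog :=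
  match p with
  | Skip => Skip
  | Push x c => Push (b + x) c
  | Pop x => Pop (b + x)
  | Seq p q => Seq (shift b p) (shift b q)
  | Case x p0 pf pt => Case (b + x) (shift b p0) (shift b pf) (shift b pt)
  | While x p => While (b + x) (shift b p)
  end.

Definition regs (l : seq word) : store := nth [::] l.

(** The stacks in [r] sit below the range of a shifted program; this is how data survive the call of
    a subprogram. *)
Definition lift_store (r : seq word) (s : store) : store :=
  fun y => if y < size r then nth [::] r y else s (y - size r).

Lemma lift_regs r l : lift_store r (regs l) = regs (r ++ l).
Proof. by apply: functional_extensionality => y; rewrite /lift_store /regs nth_cat. Qed.

Lemma lift_high r s x : lift_store r s (size r + x) = s x.
Proof. by rewrite /lift_store ltnNge leq_addr /= addKn. Qed.

Lemma lift_upd r s x w : lift_store r (upd s x w) = upd (lift_store r s) (size r + x) w.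
Proof.
apply: functional_extensionality => y; rewrite /lift_store /upd.
case: ltnP => h; last by rewrite -(eqn_add2l (size r)) subnKC.
by case: eqP => // e; move: h; rewrite e ltnNge leq_addr.
Qed.

Lemma exec_shift r p s s' t :
  exec p s s' t -> exec (shift (size r) p) (lift_store r s) (lift_store r s') t.
Proof.
elim=> {p s s' t} /=.
- by move=> s; constructor.
- by move=> x b s; rewrite lift_upd -[s x](lift_high r); constructor.
- by move=> x s; rewrite lift_upd -[s x](lift_high r); constructor.
- by move=> p q s s1 s2 t1 t2 _ IH1 _ IH2; apply: ExecSeq IH1 IH2.
- move=> x p0 pf pt s s' t _ IH; constructor; rewrite lift_high.
  by case: (s x) IH => // -[].
- by move=> x p s e; constructor; rewrite lift_high.
- move=> x p s s1 s2 t1 t2 ne _ IH1 _ IH2.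
  by apply: ExecWhileStep IH1 IH2; rewrite lift_high.
Qed.

Lemma runs_shift r p l l' T :
  runs p (regs l) (regs l') T ->
  runs (shift (size r) p) (regs (r ++ l)) (regs (r ++ l')) T.
Proof. by case=> t /(exec_shift r) + lt; rewrite !lift_regs; exists t. Qed.

Fixpoint nstacks (p : prog) : nat :=
  match p with
  | Skip => 0
  | Push x _ | Pop x => x.+1
  | Seq p q => maxn (nstacks p) (nstacks q)
  | Case x p0 pf pt => maxn x.+1 (maxn (nstacks p0) (maxn (nstacks pf) (nstacks pt)))
  | While x p => maxn x.+1 (nstacks p)
  end.

(** Only finitely many stacks can be dirty after a run, so a fixed program can clear them all before
    another one starts. *)
Lemma exec_frame p s s' t :
  exec p s s' t -> forall x, nstacks p <= x -> s' x = s x.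
Proof.
elim=> {p s s' t} //=.
- by move=> x b s y h; rewrite upd_other //; apply: contraL h => /eqP ->; rewrite -ltnNge.
- by move=> x s y h; rewrite upd_other //; apply: contraL h => /eqP ->; rewrite -ltnNge.
- by move=> p q s s1 s2 t1 t2 _ IH1 _ IH2 x; rewrite geq_max => /andP[h1 h2]; rewrite IH2 ?IH1.
- move=> x p0 pf pt s s' t _ IH y; rewrite !geq_max => /and4P[_ h0 hf ht].
  by apply: IH; case: (s x) => // -[].
- move=> x p s s1 s2 t1 t2 _ _ IH1 _ IH2 y /[dup] h; rewrite geq_max => /andP[_ h1].
  by rewrite IH2 ?IH1.
Qed.

(** * Emptying, moving and copying stacks *)

Definition drain (x : nat) (p0 p1 : prog) : prog :=
  While x (Case x Skip (Seq (Pop x) p0) (Seq (Pop x) p1)).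

(** Loop rule: [f u acc] is the store when [u] is still on stack [x] and the letters already read
    form [acc], last one first. Besides [tau], each letter costs the loop test, the case test and
    the pop. *)
Lemma runs_drain (x : nat) (p0 p1 : prog) (f : word -> word -> store) (tau : nat) :
  (forall u acc, f u acc x = u) ->
  (forall b u acc, runs (if b then p1 else p0) (upd (f (b :: u) acc) x u)
                        (f u (b :: acc)) tau) ->
  forall w acc, runs (drain x p0 p1) (f w acc) (f [::] (catrev w acc))
                     ((tau + 3) * size w + 1).
Proof.
move=> fx fs; elim=> [|b w IH] acc /=; first by apply: runs_le (runs_while_end _ _) _; rewrite ?fx ?muln0.
have -> : (tau + 3) * (size w).+1 + 1 = ((1 + tau).+1 + ((tau + 3) * size w + 1)).+1 by lia.
apply: runs_while_step (IH (b :: acc)); first by rewrite fx.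
apply: runs_case; rewrite fx.
have := runs_pop x (f (b :: w) acc); rewrite fx /= => pop.
by case: b fs pop => fs pop; apply: runs_seq pop _; [apply: (fs true)|apply: (fs false)].
Qed.

Definition clear (x : nat) : prog := drain x Skip Skip.

Lemma runs_clear x s : runs (clear x) s (upd s x [::]) (4 * size (s x) + 1).
Proof.
have := @runs_drain x Skip Skip (fun u _ => upd s x u) 1 _ _ (s x) [::].
rewrite upd_id; apply=> [u acc|b u acc]; first exact: upd_same.
by rewrite upd_upd; case: b; apply: runs_skip.
Qed.

Definition mv (x y : nat) : prog := drain x (Push y false) (Push y true).

Lemma runs_mv x y s : x != y ->
  runs (mv x y) s (upd (upd s x [::]) y (rev (s x) ++ s y)) (4 * size (s x) + 1).
Proof.
rewrite -catrevE => nxy; have nyx : y != x by rewrite eq_sym.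
have := @runs_drain x (Push y false) (Push y true)
  (fun u acc => upd (upd s x u) y acc) 1 _ _ (s x) (s y).
rewrite upd_id upd_id; apply=> [u acc|b u acc].
  by rewrite upd_other // upd_same.
set s1 := upd _ _ _.
have -> : upd (upd s x u) y (b :: acc) = upd s1 y (b :: s1 y).
  apply: functional_extensionality => z; rewrite /s1 /upd.
  case: (z =P y) => [_|ny]; first by rewrite (negbTE nyx) eqxx.
  by case: eqP.
by case: b @s1 => s1; apply: runs_push.
Qed.

Definition mv2 (x y z : nat) : prog :=
  drain x (Seq (Push y false) (Push z false)) (Seq (Push y true) (Push z true)).

Lemma runs_mv2 x y z s : x != y -> x != z -> y != z ->
  runs (mv2 x y z) s
    (upd (upd (upd s x [::]) y (rev (s x) ++ s y)) z (catrev (s x) (s z)))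
    (5 * size (s x) + 1).
Proof.
rewrite -!catrevE => nxy nxz nyz.
have [nyx nzx nzy] : [/\ y != x, z != x & z != y] by split; rewrite eq_sym.
have := @runs_drain x (Seq (Push y false) (Push z false)) (Seq (Push y true) (Push z true))
  (fun u acc => upd (upd (upd s x u) y (catrev (rev acc) (s y))) z (catrev (rev acc) (s z)))
  2 _ _ (s x) [::].
rewrite -/(rev (s x)) revK (_ : rev [::] = [::]) //= !upd_id; apply=> [u acc|b u acc].
  by rewrite upd_other // upd_other // upd_same.
rewrite !catrevE !revK /=.
set s1 := upd _ x u.
pose s2 := upd s1 y (b :: s1 y).
have -> : upd (upd (upd s x u) y (b :: acc ++ s y)) z (b :: acc ++ s z)
  = upd s2 z (b :: s2 z).
  apply: functional_extensionality => t; rewrite /s2 /s1 /upd.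
  case: (t =P z) => [_|nz]; first by rewrite ?(negbTE nzy) ?(negbTE nzx) ?eqxx.
  case: (t =P y) => [_|ny]; first by rewrite ?(negbTE nyx) ?(negbTE nyz) ?eqxx.
  by case: eqP.
by case: b @s1 @s2 => s1 s2; apply: (runs_seq (T1 := 1) (T2 := 1)); apply: runs_push.
Qed.

Lemma upd_regs l x w : upd (regs l) x w = regs (set_nth [::] l x w).
Proof. by apply: functional_extensionality => y; rewrite /regs nth_set_nth. Qed.

Lemma regs_eq l l' : (forall i, nth [::] l i = nth [::] l' i) -> regs l = regs l'.
Proof. by move=> e; apply: functional_extensionality. Qed.

(** * Polynomial-time functions on coded data *)

Inductive tree : Type := Leaf | Node of tree & tree.

(** Preorder with one bit per node is self-delimiting, so concatenated codes can be split again
    without separators. *)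
Fixpoint tword (t : tree) : word :=
  match t with
  | Leaf => [:: false]
  | Node a b => true :: tword a ++ tword b
  end.

(** Below, a pair, a list cell and a successor all become a node; a program for one type thus serves
    every type with the same codes. Numbers are coded like lists of units, that is, in unary. *)
Class Code (T : Type) := code : T -> tree.

Definition cword (T : Type) {c : Code T} (x : T) : word := tword (code x).
Definition sz (T : Type) {c : Code T} (x : T) : nat := size (cword x).

#[export] Instance code_unit : Code unit := fun _ => Leaf.
#[export] Instance code_bool : Code bool := fun b => if b then Node Leaf Leaf else Leaf.
#[export] Instance code_nat : Code nat := fix f n := if n is m.+1 then Node Leaf (f m) else Leaf.
#[export] Instance code_pair A B {cA : Code A} {cB : Code B} : Code (A * B) :=
  fun p => Node (code p.1) (code p.2).
#[export] Instance code_seq A {cA : Code A} : Code (seq A) :=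
  fix f s := if s is x :: s' then Node (code x) (f s') else Leaf.
#[export] Instance code_option A {cA : Code A} : Code (option A) :=
  fun o => if o is Some x then Node (code x) Leaf else Leaf.

Lemma cword_pair A B {cA : Code A} {cB : Code B} (a : A) (b : B) :
  cword (a, b) = true :: cword a ++ cword b.
Proof. by []. Qed.

Lemma sz_pair A B {cA : Code A} {cB : Code B} (a : A) (b : B) :
  sz (a, b) = (sz a + sz b).+1.
Proof. by rewrite /sz cword_pair /= size_cat. Qed.

Lemma sz_cons A {cA : Code A} (a : A) s : sz (a :: s) = (sz a + sz s).+1.
Proof. by rewrite /sz /cword /= size_cat. Qed.

Lemma sz_gt0 A {cA : Code A} (a : A) : 0 < sz a.
Proof. by rewrite /sz /cword; case: code. Qed.

Lemma sz_nat (n : nat) : sz n = (2 * n).+1.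
Proof.
elim: n => // n IH; have -> : sz n.+1 = (sz n).+2 by [].
by rewrite IH; lia.
Qed.

Lemma sz_bool (b : bool) : sz b <= 3.
Proof. by case: b. Qed.

Lemma sz_size A {cA : Code A} (s : seq A) : size s < sz s.
Proof. by elim: s => // x s IH; rewrite sz_cons /=; lia. Qed.

Lemma sz_cat A {cA : Code A} (s1 s2 : seq A) : (sz (s1 ++ s2)).+1 = sz s1 + sz s2.
Proof. by elim: s1 => // x s IH; rewrite cat_cons !sz_cons -addnS IH; lia. Qed.

Lemma sz_catrev A {cA : Code A} (s1 s2 : seq A) : (sz (catrev s1 s2)).+1 = sz s1 + sz s2.
Proof. by elim: s1 s2 => // x s IH s2; rewrite /= IH !sz_cons; lia. Qed.

(** The base is at least 2, so that constants and sums are absorbed by the exponent. *)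
Definition polyb (T : Type) (m g : T -> nat) : Prop :=
  exists c, forall x, g x <= (m x).+2 ^ c.

Lemma polyb_le T (m g h : T -> nat) : polyb m g -> (forall x, h x <= g x) -> polyb m h.
Proof. by case=> c gc hg; exists c => x; apply: leq_trans (hg x) (gc x). Qed.

Lemma polyb_const T (m : T -> nat) k : polyb m (fun _ => k).
Proof.
exists k => x; apply: leq_trans (ltnW (ltn_expl k (isT : 1 < 2))) _.
by case: k => // k; rewrite leq_exp2r.
Qed.

Lemma polyb_id T (m : T -> nat) : polyb m m.
Proof. by exists 1 => x; rewrite expn1; lia. Qed.

Lemma polyb_mul T (m g h : T -> nat) : polyb m g -> polyb m h -> polyb m (fun x => g x * h x).
Proof. by case=> c gc [e he]; exists (c + e) => x; rewrite expnD leq_mul. Qed.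

Lemma polyb_add T (m g h : T -> nat) : polyb m g -> polyb m h -> polyb m (fun x => g x + h x).
Proof.
case=> c gc [e he]; exists (c + e).+1 => x; rewrite expnS expnD.
have := gc x; have := he x.
have := expn_gt0 (m x).+2 c; have := expn_gt0 (m x).+2 e; rewrite /=.
move: (_ ^ c) (_ ^ e) => u v; nia.
Qed.

Lemma polyb_exp T (m g : T -> nat) e : polyb m g -> polyb m (fun x => g x ^ e).
Proof.
move=> gm; elim: e => [|e IH]; first exact: (polyb_const m 1).
by apply: polyb_le (polyb_mul gm IH) _ => x; rewrite expnS.
Qed.

Lemma polyb_comp T U (m : T -> nat) (n : U -> nat) (f : T -> U) g :
  polyb n g -> polyb m (fun x => n (f x)) -> polyb m (fun x => g (f x)).
Proof.
case=> c gc nf; apply: polyb_le (_ : polyb m (fun x => (n (f x) + 2) ^ c)) _.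
  by apply: polyb_exp; apply: polyb_add nf _; apply: polyb_const.
by move=> x; rewrite addn2.
Qed.

Lemma polyb_S T (m g : T -> nat) : polyb m g -> polyb m (fun x => (g x).+1).
Proof.
move=> gm; apply: polyb_le (polyb_add gm (polyb_const m 1)) _ => x.
by rewrite addn1.
Qed.

Ltac polyb_tac := repeat first
  [ assumption | apply: polyb_id | apply: polyb_const
  | match goal with
    | |- polyb _ (fun _ => addn _ _) => apply: polyb_add
    | |- polyb _ (fun _ => muln _ _) => apply: polyb_mul
    | |- polyb _ (fun _ => S _) => apply: polyb_S
    | |- polyb _ (fun _ => expn _ _) => apply: polyb_exp
    end ].

Definition ptime A B {cA : Code A} {cB : Code B} (f : A -> B) : Prop :=
  exists p tau, polyb (@sz A cA) tau /\
    forall a, runs p (regs [:: cword a]) (regs [:: cword (f a)]) (tau a).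

Lemma ptime_ext A B {cA : Code A} {cB : Code B} (f g : A -> B) :
  ptime f -> f =1 g -> ptime g.
Proof. by case=> p [tau [pt pr]] fg; exists p, tau; split=> // a; rewrite -fg. Qed.

Lemma ptime_sz A B {cA : Code A} {cB : Code B} (f : A -> B) :
  ptime f -> polyb (@sz A cA) (fun a => sz (f a)).
Proof.
case=> p [tau [pt pr]].
apply: polyb_le (polyb_add (polyb_id _) pt) _ => a.
exact: (runs_growth 0 (pr a)).
Qed.

(** Programs do not see types, only codes. *)
Lemma ptime_code A B A' B' {cA : Code A} {cB : Code B} {cA' : Code A'} {cB' : Code B'}
    (f : A -> B) (g : A' -> B') (h : A' -> A) :
  ptime f -> (forall a, code (h a) = code a) -> (forall a, code (g a) = code (f (h a))) ->
  ptime g.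
Proof.
case=> p [tau [pt pr]] hc gc; exists p, (fun a => tau (h a)); split.
  case: pt => c ptc; exists c => a.
  by have := ptc (h a); rewrite /sz /cword hc.
by move=> a; have := pr (h a); rewrite /cword hc gc.
Qed.

Lemma ptime_id A {cA : Code A} : ptime (fun a : A => a).
Proof.
exists Skip, (fun _ => 1); split; first exact: polyb_const.
by move=> a; apply: runs_skip.
Qed.

Lemma ptime_comp A B C {cA : Code A} {cB : Code B} {cC : Code C} (g : B -> C) (f : A -> B) :
  ptime g -> ptime f -> ptime (fun a => g (f a)).
Proof.
move=> [q [sig [qs qr]]] pf; have fs := ptime_sz pf; case: pf => [p [tau [pt pr]]].
exists (Seq p q), (fun a => tau a + sig (f a)); split.
  by apply: polyb_add pt _; apply: polyb_comp qs fs.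
by move=> a; apply: runs_seq (pr a) (qr _).
Qed.

Lemma runs_to p s s1 s2 T : runs p s s1 T -> s1 = s2 -> runs p s s2 T.
Proof. by move=> ? <-. Qed.

Ltac regs_norm := rewrite ?upd_regs /= ?catrevE ?revK ?cats0.
Ltac regs_fin := apply: regs_eq; do 8 (case => //=).
Ltac run1 t := eapply runs_to; [apply: t => // | by regs_norm; try regs_fin].
Ltac run t := eapply runs_seq; [apply: t => // | regs_norm].

(** * Splitting and joining codes on stacks *)

Definition swap : prog := Seq (mv 0 2) (Seq (mv 1 3) (Seq (mv 2 1) (mv 3 0))).

Lemma runs_swap u v : runs swap (regs [:: u; v]) (regs [:: v; u]) (8 * (size u + size v) + 4).
Proof.
eapply runs_le.
  run (@runs_mv 0 2); run (@runs_mv 1 3); run (@runs_mv 2 1).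
  run1 (@runs_mv 3 0).
by rewrite /= ?size_rev; lia.
Qed.

(** Stack [c] counts the trees still to be read; the code arrives reversed on [y]. *)
Definition split_tree (x y c : nat) : prog :=
  Seq (Push c true)
    (While c (Case x Skip (Seq (Pop x) (Seq (Push y false) (Pop c)))
                          (Seq (Pop x) (Seq (Push y true) (Push c true))))).

Lemma runs_split_tree (x y c : nat) (f : word -> word -> word -> store) :
  (forall u v n, [/\ f u v n x = u, f u v n y = v & f u v n c = n]) ->
  (forall u v n u', upd (f u v n) x u' = f u' v n) ->
  (forall u v n v', upd (f u v n) y v' = f u v' n) ->
  (forall u v n n', upd (f u v n) c n' = f u v n') ->
  forall t u v, runs (split_tree x y c) (f (tword t ++ u) v [::])
                     (f u (rev (tword t) ++ v) [::]) (6 * size (tword t) + 2).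
Proof.
move=> fv fx fy fc t u v; rewrite -catrevE.
rewrite /split_tree; set lp := While _ _.
(* Generalized over the trees [n] still pending and over the rest of the run, of time [T]: a leaf
   settles one pending tree, an inner node replaces one by two. *)
have main n S T w : runs lp (f u (catrev (tword t) w) n) S T ->
    runs lp (f (tword t ++ u) w (true :: n)) S (T + 6 * size (tword t)).
  elim: t u w n T => [|a IHa b IHb] u0 w n T /= h.
    have -> : T + 6 * 1 = ((1 + (1 + 1)).+1 + T).+2 by lia.
    apply: (runs_le (T := ((1 + (1 + 1)).+1 + T).+1)) => //.
    apply: runs_while_step h; first by case: (fv (false :: u0) w (true :: n)) => _ _ ->.
    apply: runs_case; case: (fv (false :: u0) w (true :: n)) => -> _ _.
    eapply runs_seq; first exact: runs_pop.
    case: (fv (false :: u0) w (true :: n)) => -> _ _; rewrite fx /=.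
    eapply runs_seq; first exact: runs_push.
    case: (fv u0 w (true :: n)) => _ -> _; rewrite fy.
    eapply runs_to; first exact: runs_pop.
    by case: (fv u0 (false :: w) (true :: n)) => _ _ ->; rewrite fc.
  have -> : T + 6 * (size (tword a ++ tword b)).+1 =
      ((1 + (1 + 1)).+1 + ((T + 6 * size (tword b)) + 6 * size (tword a))).+2.
    by rewrite size_cat; lia.
  apply: (runs_le (T := ((1 + (1 + 1)).+1 + ((T + 6 * size (tword b)) + 6 * size (tword a))).+1)) => //.
  rewrite -catA; set u1 := tword a ++ _.
  apply: (@runs_while_step _ _ _ (f u1 (true :: w) (true :: true :: n))).
  - by case: (fv (true :: u1) w (true :: n)) => _ _ ->.
  - apply: runs_case; case: (fv (true :: u1) w (true :: n)) => -> _ _.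
    eapply runs_seq; first exact: runs_pop.
    case: (fv (true :: u1) w (true :: n)) => -> _ _; rewrite fx /=.
    eapply runs_seq; first exact: runs_push.
    case: (fv u1 w (true :: n)) => _ -> _; rewrite fy.
    eapply runs_to; first exact: runs_push.
    by case: (fv u1 (true :: w) (true :: n)) => _ _ ->; rewrite fc.
  - apply: IHa; apply: IHb; move: h; rewrite catrevE rev_cat -catA => h.
    by rewrite !catrevE; move: h; rewrite ?catrevE.
eapply runs_le.
  eapply runs_seq; first exact: runs_push.
  case: (fv (tword t ++ u) v [::]) => _ _ ->; rewrite fc.
  apply: main; apply: runs_while_end.
  by case: (fv u (catrev (tword t) v) [::]) => _ _ ->.
by rewrite addnA addnC.
Qed.

Lemma runs_split021 t u :
  runs (split_tree 0 2 1) (regs [:: tword t ++ u])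
       (regs [:: u; [::]; rev (tword t)]) (6 * size (tword t) + 2).
Proof.
have := @runs_split_tree 0 2 1 (fun u v n => regs [:: u; n; v]) _ _ _ _ t u [::].
rewrite cats0 => h.
have -> : regs [:: tword t ++ u] = regs [:: tword t ++ u; [::]; [::]] by regs_fin.
by apply: h => *; rewrite ?upd_regs.
Qed.

Lemma runs_split134 a t u s :
  runs (split_tree 1 3 4) (regs [:: a; tword t ++ u; s])
       (regs [:: a; u; s; rev (tword t)]) (6 * size (tword t) + 2).
Proof.
have := @runs_split_tree 1 3 4 (fun u v n => regs [:: a; u; s; v; n]) _ _ _ _ t u [::].
rewrite cats0 => h.
have -> : regs [:: a; tword t ++ u; s] = regs [:: a; tword t ++ u; s; [::]; [::]] by regs_fin.
have -> : regs [:: a; u; s; rev (tword t)] = regs [:: a; u; s; rev (tword t); [::]] by regs_fin.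
by apply: h => *; rewrite ?upd_regs.
Qed.

Definition unpair : prog := Seq (Pop 0) (Seq (split_tree 0 2 1) (mv 2 1)).

Lemma runs_unpair t u :
  runs unpair (regs [:: true :: tword t ++ u]) (regs [:: u; tword t])
       (10 * size (tword t) + 4).
Proof.
eapply runs_le.
  run (@runs_pop 0); run (@runs_split021).
  run1 (@runs_mv 2 1).
by rewrite /= ?size_rev; lia.
Qed.

Definition mkpair : prog := Seq (mv 1 2) (Seq (mv 2 0) (Push 0 true)).

Lemma runs_mkpair u v :
  runs mkpair (regs [:: v; u]) (regs [:: true :: u ++ v]) (8 * size u + 3).
Proof.
eapply runs_le.
  run (@runs_mv 1 2); run (@runs_mv 2 0).
  run1 (@runs_push 0).
by rewrite /= ?size_rev; lia.
Qed.

(** Reading a stack empties it and reverses its contents; the detour through stack 2 restores the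
    order. *)
Definition dup : prog := Seq (mv 0 2) (mv2 2 0 1).

Lemma runs_dup u : runs dup (regs [:: u]) (regs [:: u; u]) (9 * size u + 2).
Proof.
eapply runs_le.
  run (@runs_mv 0 2).
  run1 (@runs_mv2 2 0 1).
by rewrite /= ?size_rev; lia.
Qed.

Lemma runs_shift1 p u l l' T :
  runs p (regs l) (regs l') T -> runs (shift 1 p) (regs (u :: l)) (regs (u :: l')) T.
Proof. exact: (@runs_shift [:: u]). Qed.

Lemma polyb_sz A B {cA : Code A} {cB : Code B} (f : A -> B) :
  ptime f -> polyb (@sz A cA) (fun a => size (cword (f a))).
Proof. exact: ptime_sz. Qed.

Lemma ptime_pair A B C {cA : Code A} {cB : Code B} {cC : Code C} (f : A -> B) (g : A -> C) :
  ptime f -> ptime g -> ptime (fun a => (f a, g a)).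
Proof.
move=> pf pg; have fs := polyb_sz pf; have gs := polyb_sz pg.
have ids := polyb_sz (@ptime_id A cA).
case: pf => p [tau [pt pr]]; case: pg => q [sig [qs qr]].
(* A program consumes its argument, so each of the two gets its own copy and runs above the stack
   that holds the other value. *)
exists (Seq dup (Seq (shift 1 q) (Seq swap (Seq (shift 1 p) mkpair)))); eexists.
split; last first.
  move=> a.
  eapply runs_seq; first exact: runs_dup.
  eapply runs_seq; first by apply: runs_shift1; apply: qr.
  eapply runs_seq; first exact: runs_swap.
  eapply runs_seq; first by apply: runs_shift1; apply: pr.
  by rewrite cword_pair; apply: runs_mkpair.
by rewrite /=; polyb_tac.
Qed.

Lemma ptime_fst A B {cA : Code A} {cB : Code B} : ptime (fun p : A * B => p.1).
Proof.
exists (Seq unpair (Seq (clear 0) (Seq (mv 1 2) (mv 2 0)))), (fun p => 30 * sz p + 30); split.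
  by polyb_tac.
case=> a b; rewrite cword_pair sz_pair /=; eapply runs_le.
  run (@runs_unpair).
  run (@runs_clear 0); run (@runs_mv 1 2).
  run1 (@runs_mv 2 0).
by rewrite /= ?size_rev /sz /cword; lia.
Qed.

Lemma ptime_snd A B {cA : Code A} {cB : Code B} : ptime (fun p : A * B => p.2).
Proof.
exists (Seq unpair (clear 1)), (fun p => 30 * sz p + 30); split.
  by polyb_tac.
case=> a b; rewrite cword_pair sz_pair /=; eapply runs_le.
  run (@runs_unpair).
  run1 (@runs_clear 1).
by rewrite /= ?size_rev /sz /cword; lia.
Qed.

Fixpoint pushes (x : nat) (w : word) : prog :=
  if w is b :: w' then Seq (pushes x w') (Push x b) else Skip.

Lemma runs_pushes x w s : runs (pushes x w) s (upd s x (w ++ s x)) (size w).+1.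
Proof.
elim: w => [|b w IH] /=; first by rewrite upd_id; apply: runs_skip.
eapply runs_le.
  eapply runs_seq; first exact: IH.
  by eapply runs_to; [exact: runs_push | rewrite upd_upd upd_same].
by rewrite addn1.
Qed.

Lemma ptime_const A B {cA : Code A} {cB : Code B} (b : B) : ptime (fun _ : A => b).
Proof.
exists (Seq (clear 0) (pushes 0 (cword b))), (fun a => 4 * sz a + 1 + (sz b).+1); split.
  by polyb_tac.
move=> a.
run (@runs_clear 0).
by run1 (@runs_pushes 0).
Qed.

(** [X] is a type sharing the codes of the non-leaf values of [T], e.g. [X0 * seq X0]
    for [T = seq X0]. *)
Lemma ptime_case A T X B {cA : Code A} {cT : Code T} {cX : Code X} {cB : Code B}
    (h : A -> T) (f : A -> B) (g : X * A -> B) (r : A -> B) :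
  ptime h -> ptime f -> ptime g ->
  (forall a, code (h a) = Leaf -> r a = f a) ->
  (forall a u v, code (h a) = Node u v ->
     exists2 x : X, code x = Node u v & r a = g (x, a)) ->
  ptime r.
Proof.
move=> ph [p [tau [pt pr]]] [q [sig [qs qr]]] rL rN.
have hs := ptime_sz ph.
have := ptime_pair ph (@ptime_id A cA); case=> k [kap [kt kr]].
case: qs => c qc.
(* Without the tag of the pair [(h a, a)], the top bit tells a leaf from a node. A leaf is removed,
   which leaves [a]; for a node the tag is restored, and the stack then holds the code of
   [(x, a)]. *)
exists (Seq k (Seq (Pop 0) (Case 0 Skip (Seq (Pop 0) p) (Seq (Push 0 true) q)))).
exists (fun a => kap a + (1 + (1 + (tau a + (sz (h a) + sz a).+3 ^ c)).+1)).
split; first by polyb_tac; apply: polyb_le (polyb_exp c (polyb_S (polyb_S (polyb_S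
   (polyb_add hs (polyb_id _)))))) _ => x.
move=> a; eapply runs_seq; first exact: kr.
rewrite cword_pair; run (@runs_pop 0).
apply: runs_case; rewrite {1}/cword.
case e: (code (h a)) => [|u v] /=.
  rewrite (rL a e); eapply runs_le; first eapply runs_seq; first exact: runs_pop.
    by rewrite upd_regs /= /cword e /=; apply: pr.
  by lia.
have [x xc ->] := rN a u v e.
eapply runs_le; first eapply runs_seq; first exact: runs_push.
  rewrite upd_regs /= /cword e /= -/(cword a).
  have -> : true :: true :: (tword u ++ tword v) ++ cword a = cword (x, a).
    by rewrite cword_pair /cword xc.
  exact: qr.
have := qc (x, a).
have -> : sz (x, a) = (sz (h a) + sz a).+1 by rewrite sz_pair /sz /cword xc e.
by lia.
Qed.

Lemma tword_inj_cat t t' u u' : tword t ++ u = tword t' ++ u' -> t = t' /\ u = u'.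
Proof.
elim: t t' u u' => [|a IHa b IHb] [|a' b'] u u' //= []; first by move=> ->.
by rewrite -!catA => /IHa[-> /IHb[-> ->]].
Qed.

Lemma tword_inj : injective tword.
Proof. by move=> t t' e; have [] := @tword_inj_cat t t' [::] [::]; rewrite ?e. Qed.

(** Stack 2 is a flag, nonempty while the letters read so far agree. The words are equal when the
    flag survives and stack 1 ends empty. *)
Definition compare_words : prog :=
  drain 0 (Case 1 (Pop 2) (Pop 1) (Seq (Pop 1) (Pop 2)))
          (Case 1 (Pop 2) (Seq (Pop 1) (Pop 2)) (Pop 1)).

Lemma runs_compare_step (c : bool) (u v : word) (b : bool) :
  runs (Case 0 Skip (Seq (Pop 0) (Case 1 (Pop 2) (Pop 1) (Seq (Pop 1) (Pop 2))))
                    (Seq (Pop 0) (Case 1 (Pop 2) (Seq (Pop 1) (Pop 2)) (Pop 1))))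
   (regs [:: c :: u; v; nseq b true])
   (regs [:: u; behead v; nseq (b && (ohead v == Some c)) true]) 8.
Proof.
case: b => /=; case: v => [|x v]; try case: x; case: c => /=.
all: eapply runs_le; [eapply runs_case; simpl; run (@runs_pop 0); eapply runs_case; simpl | ].
all: try (by run1 (@runs_pop 1)); try (by run1 (@runs_pop 2)); try by [].
all: try by [].
all: by apply: (runs_le (T := 1 + 1)) => //; run (@runs_pop 1); run1 (@runs_pop 2).
Qed.

Lemma runs_compare (u v : word) (b : bool) : exists v' : word, exists b' : bool,
  runs compare_words (regs [:: u; v; nseq b true]) (regs [:: [::]; v'; nseq b' true])
    (10 * size u + 1) /\ ((v' == [::]) && b' = (u == v) && b) /\ size v' <= size v.
Proof.
elim: u v b => [|c u IH] v b.
  exists v, b; split; first by apply: runs_while_end.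
  by rewrite [in RHS]eq_sym.
pose v1 := behead v; pose b1 := b && (ohead v == Some c).
have [v' [b' [r [e l]]]] := IH v1 b1.
exists v', b'; split; last first.
  rewrite e /b1 /v1; split; last by apply: leq_trans l _; rewrite size_behead leq_pred.
  case: v {v1 b1 r e l} => [|x v] /=; first by rewrite !andbF.
  by rewrite eqseq_cons -[Some x == Some c]/(x == c) [x == c]eq_sym; case: (c == x) (u == v) b => [] [] [].
eapply runs_le; first by apply: runs_while_step (runs_compare_step _ _ _ _) r.
by rewrite /=; lia.
Qed.

Lemma ptime_eq A (T : eqType) {cA : Code A} {cT : Code T} (f g : A -> T) :
  injective (@code T cT) -> ptime f -> ptime g -> ptime (fun a => f a == g a).
Proof.
move=> inj pf pg; have fs := polyb_sz pf; have gs := polyb_sz pg.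
have := ptime_pair pf pg; case=> k [kap [kt kr]].
exists (Seq k (Seq unpair (Seq (Push 2 true) (Seq compare_words
   (Seq (Case 1 Skip (Pop 2) (Pop 2)) (Seq (clear 1)
     (Case 2 (Push 0 false) Skip (Seq (Pop 2) (pushes 0 [:: true; false; false]))))))))).
exists (fun a => kap a + (30 * size (cword (f a)) + 30 * size (cword (g a)) + 30)); split.
  by polyb_tac.
move=> a; eapply runs_seq; first exact: kr.
rewrite cword_pair; eapply runs_le.
  eapply runs_seq; first exact: runs_unpair.
  run (@runs_push 2).
  have [v' [b' [r [e l]]]] := runs_compare (cword (g a)) (cword (f a)) true.
  eapply runs_seq; first exact: r.
  set b1 := (v' == [::]) && b' in e.
  eapply (@runs_seq _ _ _ (regs [:: [::]; v'; nseq b1 true]) _ 2).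
    apply: runs_case; rewrite /= /b1; case: (v') => [|[] v2] /=; first exact: runs_skip.
      by case: (b'); run1 (@runs_pop 2).
    by case: (b'); run1 (@runs_pop 2).
  eapply runs_seq; first apply: (runs_le (T' := 4 * size (cword (f a)) + 1)).
  - exact: runs_clear.
  - by rewrite /=; lia.
  regs_norm.
  have -> : cword (f a == g a) = cword b1.
    congr cword; rewrite e andbT; apply/eqP/eqP => [->//|].
    by move=> /tword_inj/inj.
  case: (b1); apply: (runs_le (T' := 10)); try (apply: runs_case => /=).
  - run (@runs_pop 2). by run1 (@runs_pushes 0 [:: true; false; false]).
  - by [].
  - by run1 (@runs_push 0).
  - by [].
by rewrite /sz /cword; lia.
Qed.

Lemma runs_shift2 p u v l l' T :
  runs p (regs l) (regs l') T -> runs (shift 2 p) (regs (u :: v :: l)) (regs (u :: v :: l')) T.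
Proof. exact: (@runs_shift [:: u; v]). Qed.

(** A polynomial-time step may square the size of the accumulator in every round, so a polynomial
    bound [beta] on all intermediate values has to be supplied. *)
Lemma ptime_foldl A X S {cA : Code A} {cX : Code X} {cS : Code S}
    (l : A -> seq X) (init : A -> S) (step : A * (X * S) -> S) (beta : A -> nat) :
  ptime l -> ptime init -> ptime step -> polyb (@sz A cA) beta ->
  (forall a l1 l2, l a = l1 ++ l2 ->
     sz (foldl (fun s x => step (a, (x, s))) (init a) l1) <= beta a) ->
  ptime (fun a => foldl (fun s x => step (a, (x, s))) (init a) (l a)).
Proof.
move=> pl pinit [q [sig [[c qs] qr]]] pbeta bnd.
have lsz := ptime_sz pl; have isz := ptime_sz pinit.
have := ptime_pair (ptime_pair pinit pl) (@ptime_id A cA); case=> k [kap [kt kr]].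
(* Stacks 0, 1 and 2 hold the parameter, the unread list and the accumulator. A top bit [false] on
   stack 1 is the end of the list, and popping it stops the loop; otherwise the code of
   [(a, (x, s))] is assembled on stack 2, where [q] then runs. *)
pose body := Case 1 Skip (Pop 1) (Seq (Pop 1) (Seq (split_tree 1 3 4) (Seq (mv 3 2)
  (Seq (Push 2 true) (Seq (mv 0 3) (Seq (mv2 3 0 2) (Seq (Push 2 true) (shift 2 q)))))))).
exists (Seq k (Seq unpair (Seq (shift 1 unpair) (Seq (While 1 body)
  (Seq (clear 0) (Seq (mv 2 3) (mv 3 0))))))).
pose itertime (a : A) := 9 * @sz _ cA a + 10 * @sz _ (@code_seq X cX) (l a) + 12
  + (@sz _ cA a + @sz _ (@code_seq X cX) (l a) + beta a).+4 ^ c.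
exists (fun a => kap a + (20 * sz (init a) + 20 * sz (l a) + 30 + (sz (l a)).+1 * itertime a
  + 10 * sz a + 10 * beta a)).
split.
  rewrite /itertime; polyb_tac.
move=> a; eapply runs_seq; first exact: kr.
rewrite cword_pair; eapply runs_le.
  eapply runs_seq; first exact: runs_unpair.
  rewrite -/(cword (init a, l a)) cword_pair.
  eapply runs_seq; first by apply: runs_shift1; exact: runs_unpair.
  have loop l1 l2 : l a = l1 ++ l2 ->
     runs (While 1 body)
       (regs [:: cword a; cword l2; cword (foldl (fun s x => step (a, (x, s))) (init a) l1)])
       (regs [:: cword a; [::]; cword (foldl (fun s x => step (a, (x, s))) (init a) (l a))])
       ((size l2).+1 * itertime a).
    elim: l2 l1 => [|x l2 IH] l1 e.
      eapply runs_le; first eapply runs_while_step => //.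
      - apply: runs_case => /=; first exact: runs_pop.
      - regs_norm; rewrite e cats0; exact: runs_while_end.
      by rewrite /itertime; lia.
    set s := foldl _ _ l1.
    have e' : l a = rcons l1 x ++ l2 by rewrite cat_rcons.
    have := IH _ e'; rewrite foldl_rcons -/s => {}IH.
    eapply runs_le; first apply: runs_while_step IH => //.
    + apply: runs_case => /=; run (@runs_pop 1).
      eapply runs_seq; first exact: runs_split134.
      run (@runs_mv 3 2); run (@runs_push 2); run (@runs_mv 0 3).
      run (@runs_mv2 3 0 2); run (@runs_push 2).
      have -> : regs [:: cword a; cword l2; true :: cword a ++ true :: tword (code x) ++ cword s;
               [::]] = regs [:: cword a; cword l2; cword (a, (x, s))].
        by rewrite !cword_pair; regs_fin.
      by apply: runs_shift2; apply: qr.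
    have szx : sz x <= sz (l a).
      have := @sz_cat X cX l1 (x :: l2); have := @sz_cons X cX x l2; have := @sz_gt0 _ (@code_seq X cX) l1; rewrite -e.
      lia.
    have szs : sz s <= beta a by apply: bnd e.
    have qx : sig (a, (x, s)) <= (sz a + sz (l a) + beta a).+4 ^ c.
      apply: leq_trans (qs _) _; rewrite !sz_pair.
      by case: (c) => // c'; rewrite leq_exp2r //; lia.
    have it : 10 * sz x + 9 * sz a + 12 + sig (a, (x, s)) <= itertime a.
      by rewrite /itertime; move: szx qx; move: (_ ^ c); lia.
    rewrite /= ?size_rev [(size l2).+2 * _]mulSn; move: it.
    by move: (itertime a) => M; move: (_.+1 * M) => M'; rewrite /sz /cword; lia.
  eapply runs_seq; first exact: (loop [::] (l a)).
  run (@runs_clear 0); run (@runs_mv 2 3).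
  by run1 (@runs_mv 3 0).
have szr : sz (foldl (fun s x => step (a, (x, s))) (init a) (l a)) <= beta a.
  by apply: (bnd a (l a) [::]); rewrite cats0.
have : (size (l a)).+1 * itertime a <= (sz (l a)).+1 * itertime a.
  by rewrite leq_mul2r ltnS (ltnW (sz_size _)) orbT.
move: szr; move: (itertime a) => M; move: (_.+1 * M) (_.+1 * M) => M1 M2.
have e2 : size (tword (code (init a, l a))) = (sz (init a) + sz (l a)).+1.
  by rewrite /= size_cat.
rewrite /= ?size_rev in e2 *; move: e2; rewrite /sz /cword; lia.
Qed.

(** * Closure properties: booleans, lists, numbers *)

Lemma ptime_fst_of A {cA : Code A} B C {cB : Code B} {cC : Code C} (f : A -> B * C) :
  ptime f -> ptime (fun a => (f a).1).
Proof. exact: ptime_comp (@ptime_fst _ _ _ _). Qed.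

Lemma ptime_snd_of A {cA : Code A} B C {cB : Code B} {cC : Code C} (f : A -> B * C) :
  ptime f -> ptime (fun a => (f a).2).
Proof. exact: ptime_comp (@ptime_snd _ _ _ _). Qed.

Lemma ptime_if A {cA : Code A} B {cB : Code B} (b : A -> bool) (f g : A -> B) :
  ptime b -> ptime f -> ptime g -> ptime (fun a => if b a then f a else g a).
Proof.
move=> pb pf pg.
apply: (@ptime_case A bool (unit * unit) B _ _ _ _ b g (fun p => f p.2)) => //.
- exact: (ptime_comp pf (@ptime_snd _ _ _ _)).
- by move=> a; case: (b a).
- by move=> a u v; case: (b a) => // -[<- <-]; exists (tt, tt).
Qed.

Lemma ptime_neg A {cA : Code A} (b : A -> bool) : ptime b -> ptime (fun a => ~~ b a).
Proof.
move=> pb; apply: (ptime_ext (f := fun a => if b a then false else true)) => [|a].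
  by apply: ptime_if => //; apply: ptime_const.
by case: (b a).
Qed.

Lemma ptime_and A {cA : Code A} (b c : A -> bool) : ptime b -> ptime c -> ptime (fun a => b a && c a).
Proof. by move=> pb pc; apply: ptime_if => //; apply: ptime_const. Qed.

Lemma ptime_or A {cA : Code A} (b c : A -> bool) : ptime b -> ptime c -> ptime (fun a => b a || c a).
Proof. by move=> pb pc; apply: ptime_if => //; apply: ptime_const. Qed.

Lemma ptime_imply A {cA : Code A} (b c : A -> bool) : ptime b -> ptime c -> ptime (fun a => b a ==> c a).
Proof. by move=> pb pc; apply: ptime_if => //; apply: ptime_const. Qed.

Lemma ptime_cons A {cA : Code A} B {cB : Code B} (f : A -> B) (g : A -> seq B) :
  ptime f -> ptime g -> ptime (fun a => f a :: g a).
Proof. by move=> pf pg; apply: (ptime_code (h := id) (ptime_pair pf pg)). Qed.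

Lemma ptime_Some A {cA : Code A} B {cB : Code B} (f : A -> B) : ptime f -> ptime (fun a => Some (f a)).
Proof.
by move=> pf; apply: (ptime_code (h := id) (ptime_cons pf (@ptime_const _ _ _ _ [::]))).
Qed.

Lemma ptime_lcase A {cA : Code A} X B {cX : Code X} {cB : Code B} (l : A -> seq X) (f : A -> B)
    (g : A -> X -> seq X -> B) :
  ptime l -> ptime f -> ptime (fun p : (X * seq X) * A => g p.2 p.1.1 p.1.2) ->
  ptime (fun a => if l a is x :: l' then g a x l' else f a).
Proof.
move=> pl pf pg; apply: (ptime_case pl pf pg) => [a|a u v].
  by case: (l a).
by case: (l a) => // x l' [<- <-]; exists (x, l').
Qed.

Lemma ptime_ocase A {cA : Code A} X B {cX : Code X} {cB : Code B} (l : A -> option X) (f : A -> B)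
    (g : A -> X -> B) :
  ptime l -> ptime f -> ptime (fun p : (X * unit) * A => g p.2 p.1.1) ->
  ptime (fun a => if l a is Some x then g a x else f a).
Proof.
move=> pl pf pg; apply: (ptime_case pl pf pg) => [a|a u v].
  by case: (l a).
by case: (l a) => // x [<- <-]; exists (x, tt).
Qed.

Lemma ptime_behead A {cA : Code A} X {cX : Code X} (l : A -> seq X) : ptime l -> ptime (fun a => behead (l a)).
Proof.
move=> pl; apply: (ptime_ext (f := fun a => if l a is x :: l' then l' else [::])) => [|a].
  apply: ptime_lcase => //; first exact: ptime_const.
  exact: ptime_snd_of (@ptime_fst _ _ _ _).
by case: (l a).
Qed.

Lemma ptime_head A {cA : Code A} X {cX : Code X} (x0 : X) (l : A -> seq X) :
  ptime l -> ptime (fun a => head x0 (l a)).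
Proof.
move=> pl; apply: (ptime_ext (f := fun a => if l a is x :: l' then x else x0)) => [|a].
  apply: ptime_lcase => //; first exact: ptime_const.
  exact: ptime_fst_of (@ptime_fst _ _ _ _).
by case: (l a).
Qed.

Lemma ptime_S A {cA : Code A} (f : A -> nat) : ptime f -> ptime (fun a => (f a).+1).
Proof.
move=> pf; apply: (ptime_code (h := id) (ptime_cons (@ptime_const _ _ _ _ tt) (_ : ptime (fun a => nseq (f a) tt)))) => //.
  apply: (ptime_code (h := id) pf) => // a /=; elim: (f a) => //= n IH; exact: (congr1 (Node Leaf) IH).
by move=> a /=; congr Node; elim: (f a) => //= n IH; exact: (congr1 (Node Leaf) IH).
Qed.

Lemma ptime_nseq_unit A {cA : Code A} (f : A -> nat) : ptime f -> ptime (fun a => nseq (f a) tt).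
Proof.
move=> pf; apply: (ptime_code (h := id) pf) => // a /=.
elim: (f a) => //= n IH; exact: (congr1 (Node Leaf) IH).
Qed.

(** Additive growth is harmless, since there are fewer than [sz (l a)] rounds. The invariant [I]
    serves to bound the growth in terms of [a] when it depends on the accumulator. *)
Lemma ptime_foldl_inv A {cA : Code A} X S {cX : Code X} {cS : Code S}
    (l : A -> seq X) (init : A -> S) (step : A -> X -> S -> S) (beta : A -> nat)
    (I : A -> S -> Prop) :
  ptime l -> ptime init -> ptime (fun p : A * (X * S) => step p.1 p.2.1 p.2.2) ->
  polyb (@sz A cA) beta ->
  (forall a, I a (init a)) ->
  (forall a x s, sz x < sz (l a) -> I a s -> I a (step a x s) /\ sz (step a x s) <= sz s + beta a) ->
  ptime (fun a => foldl (fun s x => step a x s) (init a) (l a)).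
Proof.
move=> pl pi ps pb I0 bnd.
apply: (@ptime_foldl A X S cA cX cS l init (fun p => step p.1 p.2.1 p.2.2)
   (fun a => sz (init a) + sz (l a) * beta a)) => //.
  by apply: polyb_add; [|apply: polyb_mul => //]; apply: ptime_sz.
move=> a l1 l2 e; apply: (@leq_trans (sz (init a) + size l1 * beta a)); last first.
  rewrite leq_add2l leq_mul2r; apply/orP; right.
  apply: leq_trans (_ : size (l a) <= _); first by rewrite e size_cat leq_addr.
  exact: ltnW (sz_size _).
have : all (fun x => sz x < sz (l a)) l1.
  have : all (fun x => sz x < sz (l a)) (l a).
    elim: (l a) => //= x s IH; rewrite sz_cons ltnS leq_addr /=.
    by apply: sub_all IH => y; rewrite /=; lia.
  by rewrite {2}e all_cat => /andP[].
suff main : all (fun x => @sz X cX x < @sz _ (@code_seq X cX) (l a)) l1 ->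
    I a (foldl (fun s x => step a x s) (init a) l1) /\
    @sz S cS (foldl (fun s x => step a x s) (init a) l1) <=
      @sz S cS (init a) + size l1 * beta a.
  by move=> /main[].
elim/last_ind: l1 {e} => [|l1 x IH]; first by move=> _; split; [exact: I0 | by rewrite mul0n addn0].
rewrite /= all_rcons foldl_rcons size_rcons => /andP[hx /IH[Is {}IH]].
have [I1 le1] := bnd a x _ hx Is.
by split=> //; move: le1 IH; rewrite mulSn /=; lia.
Qed.

Lemma ptime_foldl_growth A {cA : Code A} X S {cX : Code X} {cS : Code S}
    (l : A -> seq X) (init : A -> S) (step : A -> X -> S -> S) (beta : A -> nat) :
  ptime l -> ptime init -> ptime (fun p : A * (X * S) => step p.1 p.2.1 p.2.2) ->
  polyb (@sz A cA) beta ->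
  (forall a x s, sz x < sz (l a) -> sz (step a x s) <= sz s + beta a) ->
  ptime (fun a => foldl (fun s x => step a x s) (init a) (l a)).
Proof.
move=> pl pi ps pb bnd; apply: (@ptime_foldl_inv _ _ _ _ _ _ _ _ step beta (fun _ _ => True)) => //.
by move=> a x s h _; split=> //; apply: bnd.
Qed.

Lemma ptime_catrev A {cA : Code A} X {cX : Code X} (f g : A -> seq X) :
  ptime f -> ptime g -> ptime (fun a => catrev (f a) (g a)).
Proof.
move=> pf pg; apply: (@ptime_ext _ _ _ _
    (fun a => foldl (fun s x => x :: s) (g a) (f a))) => [|a].
  apply: (@ptime_foldl_growth _ _ _ _ _ _ _ _ (fun a x s => x :: s) (fun a => (sz (f a)).+1)) => //.
  - by apply: ptime_cons; [apply: ptime_fst_of|apply: ptime_snd_of]; apply: ptime_snd.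
  - by apply: polyb_S; apply: ptime_sz.
  - by move=> a x s h; rewrite sz_cons; lia.
by elim: (f a) (g a) => //= x s IH g'; rewrite IH.
Qed.

Lemma ptime_rev A {cA : Code A} X {cX : Code X} (f : A -> seq X) : ptime f -> ptime (fun a => rev (f a)).
Proof. by move=> pf; apply: ptime_catrev => //; apply: ptime_const. Qed.

Lemma ptime_cat A {cA : Code A} X {cX : Code X} (f g : A -> seq X) :
  ptime f -> ptime g -> ptime (fun a => f a ++ g a).
Proof.
move=> pf pg; apply: (ptime_ext (f := fun a => catrev (rev (f a)) (g a))) => [|a].
  by apply: ptime_catrev => //; apply: ptime_rev.
by rewrite catrevE revK.
Qed.

Lemma ptime_rcons A {cA : Code A} X {cX : Code X} (f : A -> seq X) (x : A -> X) :
  ptime f -> ptime x -> ptime (fun a => rcons (f a) (x a)).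
Proof.
move=> pf px; apply: (ptime_ext (f := fun a => f a ++ [:: x a])) => [|a].
  by apply: ptime_cat => //; apply: ptime_cons => //; apply: ptime_const.
by rewrite cats1.
Qed.

Lemma ptime_flatmap A {cA : Code A} X Y {cX : Code X} {cY : Code Y} (l : A -> seq X) (h : A -> X -> seq Y) :
  ptime l -> ptime (fun p : A * X => h p.1 p.2) ->
  ptime (fun a => flatten [seq h a x | x <- l a]).
Proof.
move=> pl ph; apply: (ptime_ext (f := fun a => rev (foldl (fun s x => catrev (h a x) s) [::] (l a)))) => [|a].
  case: (ptime_sz ph) => c hc; apply: ptime_rev.
  apply: (@ptime_foldl_growth _ _ _ _ _ _ _ _ (fun a x s => catrev (h a x) s)
    (fun a => (sz a + sz (l a)).+3 ^ c)) => //; first exact: ptime_const.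
  - apply: ptime_catrev; last by apply: ptime_snd_of; apply: ptime_snd.
    apply: (ptime_comp (f := fun p : A * (X * seq Y) => (p.1, p.2.1)) ph).
    by apply: ptime_pair; [apply: ptime_fst|apply: ptime_fst_of; apply: ptime_snd].
  - by apply: polyb_exp; do 3 apply: polyb_S; apply: polyb_add; [apply: polyb_id|apply: ptime_sz].
  - move=> a x s hx; have := @sz_catrev _ cY (h a x) s.
    have := hc (a, x); rewrite sz_pair /=.
    have : (sz a + sz x).+3 ^ c <= (sz a + sz (l a)).+3 ^ c.
      by case: (c) => // c'; rewrite leq_exp2r //; lia.
    by lia.
have -> s : foldl (fun s x => catrev (h a x) s) s (l a)
   = catrev (flatten [seq h a x | x <- l a]) s.
  by elim: (l a) s => //= x l' IH s; rewrite IH !catrevE rev_cat catA.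
exact: revK.
Qed.

Lemma ptime_map A {cA : Code A} X Y {cX : Code X} {cY : Code Y} (l : A -> seq X) (h : A -> X -> Y) :
  ptime l -> ptime (fun p : A * X => h p.1 p.2) -> ptime (fun a => [seq h a x | x <- l a]).
Proof.
move=> pl ph; apply: (ptime_ext (f := fun a => flatten [seq [:: h a x] | x <- l a])) => [|a].
  by apply: (ptime_flatmap (h := fun a x => [:: h a x])) => //; apply: ptime_cons => //; apply: ptime_const.
by elim: (l a) => //= x s ->.
Qed.

Lemma ptime_filter A {cA : Code A} X {cX : Code X} (l : A -> seq X) (h : A -> X -> bool) :
  ptime l -> ptime (fun p : A * X => h p.1 p.2) -> ptime (fun a => [seq x <- l a | h a x]).
Proof.
move=> pl ph; apply: (ptime_ext (f := fun a => flatten [seq if h a x then [:: x] else [::] | x <- l a])) => [|a].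
  apply: (ptime_flatmap (h := fun a x => if h a x then [:: x] else [::])) => //.
  apply: ptime_if => //; last exact: ptime_const.
  by apply: ptime_cons; [apply: ptime_snd|apply: ptime_const].
by elim: (l a) => //= x s ->; case: (h a x).
Qed.

Lemma ptime_allpairs A X Y Z {cA : Code A} {cX : Code X} {cY : Code Y} {cZ : Code Z}
    (l : A -> seq X) (m : A -> seq Y) (h : A -> X -> Y -> Z) :
  ptime l -> ptime m -> ptime (fun p : A * X * Y => h p.1.1 p.1.2 p.2) ->
  ptime (fun a => [seq h a x y | x <- l a, y <- m a]).
Proof.
move=> pl pm ph.
apply: (ptime_flatmap (h := fun a x => [seq h a x y | y <- m a])) => //.
apply: (ptime_map (l := fun p : A * X => m p.1) (h := fun p y => h p.1 p.2 y)) => //.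
exact: (ptime_comp pm (@ptime_fst _ _ _ _)).
Qed.

Lemma ptime_has A {cA : Code A} X {cX : Code X} (l : A -> seq X) (h : A -> X -> bool) :
  ptime l -> ptime (fun p : A * X => h p.1 p.2) -> ptime (fun a => has (h a) (l a)).
Proof.
move=> pl ph; apply: (ptime_ext (f := fun a =>
   if [seq x <- l a | h a x] is x :: l' then true else false)) => [|a].
  by apply: ptime_lcase; [apply: ptime_filter|apply: ptime_const|apply: ptime_const].
by elim: (l a) => //= x s; case: (h a x).
Qed.

Lemma ptime_all A {cA : Code A} X {cX : Code X} (l : A -> seq X) (h : A -> X -> bool) :
  ptime l -> ptime (fun p : A * X => h p.1 p.2) -> ptime (fun a => all (h a) (l a)).
Proof.
move=> pl ph; apply: (ptime_ext (f := fun a => ~~ has (fun x => ~~ h a x) (l a))) => [|a].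
  apply: ptime_neg; apply: (ptime_has (h := fun a x => ~~ h a x)) => //.
  exact: ptime_neg.
by rewrite -[LHS]negbK -all_predC -[RHS]negbK; congr (~~ ~~ _); apply: eq_all => x /=; rewrite ?negbK.
Qed.

Lemma ptime_size A {cA : Code A} X {cX : Code X} (l : A -> seq X) : ptime l -> ptime (fun a => size (l a)).
Proof.
move=> pl; have pm : ptime (fun a => [seq tt | _ <- l a]).
  by apply: (ptime_map (h := fun _ _ => tt)) => //; apply: ptime_const.
apply: (ptime_code (h := id) pm) => // a /=.
by elim: (l a) => //= x s IH; apply: (congr1 (Node Leaf) IH).
Qed.

Lemma sz_iota m n : sz (iota m n) <= n * (2 * (m + n) + 2) + 1.
Proof.
elim: n m => // n IH m; have := IH m.+1.
have e : m.+1 + n = m + n.+1 by lia.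
have -> : iota m n.+1 = m :: iota m.+1 n by [].
rewrite sz_cons sz_nat e [n.+1 * _]mulSn; lia.
Qed.

Lemma ptime_iota A {cA : Code A} (n : A -> nat) : ptime n -> ptime (fun a => iota 0 (n a)).
Proof.
move=> pn.
(* The list is built backwards, so its head doubles as the counter. *)
pose step (s : seq nat) := if s is x :: s' then x.+1 :: s else [:: 0].
have fE j : foldl (fun s _ => step s) [::] (nseq j tt) = rev (iota 0 j).
  elim: j => // j IH; rewrite -addn1 nseqD foldl_cat IH iotaD rev_cat /= /step /=.
  case: j {IH} => // j; rewrite -addn1 iotaD rev_cat /= add0n addn1 //.
apply: (ptime_ext (f := fun a => rev (foldl (fun s _ => step s) [::] (nseq (n a) tt)))) => [|a].
  apply: ptime_rev.
  have pg : ptime (fun p : A * (unit * seq nat) => step p.2.2).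
    apply: ptime_lcase; first by do 2 apply: ptime_snd_of; apply: ptime_id.
      exact: ptime_const.
    apply: ptime_cons => //.
      by apply: ptime_S; do 2 apply: ptime_fst_of; apply: ptime_id.
    by do 2 apply: ptime_snd_of; apply: ptime_snd_of; apply: ptime_id.
  apply: (@ptime_foldl _ _ _ _ _ _ (fun a => nseq (n a) tt) (fun _ => [::])
    (fun p : A * (unit * seq nat) => step p.2.2) (fun a => sz (n a) * (2 * sz (n a) + 2) + 1)) => //.
  - exact: ptime_nseq_unit.
  - exact: ptime_const.
  - by have := ptime_sz pn => h; polyb_tac.
  move=> a l1 l2 e; have : size l1 <= n a by rewrite -(size_nseq (n a) tt) e size_cat leq_addr.
  have -> : l1 = nseq (size l1) tt by elim: (l1) => //= -[] s {1}->.
  rewrite size_nseq fE => h; have := @sz_catrev _ code_nat (iota 0 (size l1)) [::].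
  have := sz_iota 0 (size l1); rewrite sz_nat -/(rev _); have -> : sz (Nil nat) = 1 by [].
  nia.
by rewrite fE revK.
Qed.

Lemma ptime_mkseq A {cA : Code A} X {cX : Code X} (n : A -> nat) (h : A -> nat -> X) :
  ptime n -> ptime (fun p : A * nat => h p.1 p.2) -> ptime (fun a => mkseq (h a) (n a)).
Proof. by move=> pn ph; apply: ptime_map => //; apply: ptime_iota. Qed.

Lemma ptime_drop A {cA : Code A} X {cX : Code X} (n : A -> nat) (l : A -> seq X) :
  ptime n -> ptime l -> ptime (fun a => drop (n a) (l a)).
Proof.
move=> pn pl; apply: (ptime_ext (f := fun a => foldl (fun s _ => behead s) (l a) (nseq (n a) tt))) => [|a].
  apply: (@ptime_foldl_growth _ _ _ _ _ _ _ _ (fun a x s => behead s) (fun _ => 0)) => //.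
  - exact: ptime_nseq_unit.
  - by apply: ptime_behead; do 2 apply: ptime_snd_of; apply: ptime_id.
  - exact: polyb_const.
  - by move=> a _ [] //= x s _; rewrite sz_cons; lia.
by elim: (n a) (l a) => [|m IH] [|x s] //=; rewrite IH ?drop_nil.
Qed.

Lemma ptime_nth A {cA : Code A} X {cX : Code X} (x0 : X) (l : A -> seq X) (n : A -> nat) :
  ptime l -> ptime n -> ptime (fun a => nth x0 (l a) (n a)).
Proof.
move=> pl pn; apply: (ptime_ext (f := fun a => head x0 (drop (n a) (l a)))) => [|a].
  by apply: ptime_head; apply: ptime_drop.
by rewrite -nth0 nth_drop addn0.
Qed.

Lemma ptime_leq A {cA : Code A} (m n : A -> nat) :
  ptime m -> ptime n -> ptime (fun a => m a <= n a).
Proof.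
move=> pm pn; apply: (ptime_ext (f := fun a => if drop (n a) (nseq (m a) tt) is _ :: _ then false else true)) => [|a].
  apply: ptime_lcase; try exact: ptime_const.
  by apply: ptime_drop => //; apply: ptime_nseq_unit.
by rewrite drop_nseq -subn_eq0; case: (_ - _).
Qed.

Lemma code_nat_inj : injective (@code nat _).
Proof. by elim=> [|n IH] [|m] // [] /IH ->. Qed.

Lemma code_bool_inj : injective (@code bool _).
Proof. by move=> [] []. Qed.

Lemma code_pair_inj A B {cA : Code A} {cB : Code B} :
  injective cA -> injective cB -> injective (@code (A * B) _).
Proof. by move=> iA iB [a b] [a' b'] [] /iA -> /iB ->. Qed.

Lemma code_seq_inj A {cA : Code A} : injective cA -> injective (@code (seq A) _).
Proof. by move=> iA; elim=> [|x s IH] [|y s'] // [] /iA -> /IH ->. Qed.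

Lemma code_option_inj A {cA : Code A} : injective cA -> injective (@code (option A) _).
Proof. by move=> iA [x|] [y|] // [] /iA ->. Qed.

(** * Composition with fpt-reductions *)

(** The literals are tree codes: a successor and a list cell over [false] both begin with
    [[:: true; false]], a list cell over [true] with [[:: true; true; false; false]]. *)
Definition word_nat_to_code : prog :=
  Seq (mv 0 2) (Seq (Push 0 false)
    (Seq (drain 1 Skip (pushes 0 [:: true; false])) (Seq (Push 0 false)
      (Seq (drain 2 (pushes 0 [:: true; false]) (pushes 0 [:: true; true; false; false]))
        (Push 0 true))))).

Definition word_nat_of_code : prog :=
  Seq unpair (Seq
    (While 1 (Case 1 Skip (Pop 1)
      (Seq (Pop 1) (Case 1 Skip (Seq (Pop 1) (Push 2 false))
         (Seq (Pop 1) (Seq (Pop 1) (Seq (Pop 1) (Push 2 true))))))))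
    (Seq (drain 0 Skip (Push 1 true)) (mv 2 0))).

Lemma runs_word_nat_to_code (w : word) (k : nat) :
  runs word_nat_to_code (regs [:: w; nseq k true]) (regs [:: cword (w, k)])
    (20 * (size w + k) + 20).
Proof.
eapply runs_le.
  run (@runs_mv 0 2); run (@runs_push 0).
  eapply runs_seq.
    pose f (u acc : word) := regs [:: @cword nat code_nat (count id acc); u; rev w].
    apply: (@runs_drain 1 Skip (pushes 0 [:: true; false]) f 3 _ _ (nseq k true) [::]) => // b u acc.
    rewrite /f upd_regs; case: b => /=; last by apply: runs_le (runs_skip _) _.
    by run1 (@runs_pushes 0 [:: true; false]).
  have -> : catrev (nseq k true) [::] = nseq k true.
    by rewrite catrevE cats0; apply: rev_nseq.
  rewrite count_nseq mul1n; run (@runs_push 0).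
  eapply runs_seq.
    pose f (u acc : word) := regs [:: @cword (seq bool) (code_seq (cA := code_bool)) acc ++ @cword nat code_nat k; [::]; u].
    apply: (@runs_drain 2 (pushes 0 [:: true; false]) (pushes 0 [:: true; true; false; false]) f 5 _ _ (rev w) [::]) => // b u acc.
    rewrite /f upd_regs; case: b => /=.
      by run1 (@runs_pushes 0 [:: true; true; false; false]).
    by apply: (runs_le (T := 3)) => //; run1 (@runs_pushes 0 [:: true; false]).
  rewrite -/(rev (rev w)) revK; by run1 (@runs_push 0).
by rewrite /= ?size_rev ?size_nseq; lia.
Qed.

Lemma runs_word_nat_of_code (w : word) (k : nat) :
  runs word_nat_of_code (regs [:: cword (w, k)]) (regs [:: w; nseq k true])
    (120 * sz (w, k)).
Proof.
rewrite cword_pair; eapply runs_le.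
  eapply runs_seq; first exact: runs_unpair.
  eapply runs_seq.
    have loop : forall (v acc : word), runs (While 1 (Case 1 Skip (Pop 1)
      (Seq (Pop 1) (Case 1 Skip (Seq (Pop 1) (Push 2 false))
         (Seq (Pop 1) (Seq (Pop 1) (Seq (Pop 1) (Push 2 true))))))))
         (regs [:: cword k; cword v; acc]) (regs [:: cword k; [::]; catrev v acc]) (10 * (size v).+1).
      elim=> [|b v IH] acc.
        eapply runs_le; first eapply runs_while_step => //.
        - apply: runs_case => /=; first exact: runs_pop.
        - by regs_norm; apply: runs_while_end.
        by [].
      apply: (runs_le (T := (8 + 10 * (size v).+1).+1)); last by rewrite /=; lia.
      apply: runs_while_step (IH (b :: acc)) => //.
      apply: runs_case => /=; apply: (runs_le (T := 1 + 6)) => //; run (@runs_pop 1).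
      apply: runs_case => /=; case: b => /=.
        apply: (runs_le (T := 1 + (1 + (1 + 1)))) => //; do 3 run (@runs_pop 1).
        by run1 (@runs_push 2).
      apply: (runs_le (T := 1 + 1)) => //; run (@runs_pop 1).
      by run1 (@runs_push 2).
    have -> : regs [:: cword k; tword (code w)] = regs [:: cword k; cword w; [::]] by regs_fin.
    exact: loop.
  eapply runs_seq.
    pose f (u acc : word) := regs [:: u; nseq (count id acc) true; rev w].
    apply: (@runs_drain 0 Skip (Push 1 true) f 1 _ _ (cword k) [::]) => // b u acc.
    rewrite /f upd_regs; case: b => /=; last by apply: runs_le (runs_skip _) _.
    by run1 (@runs_push 1).
  (* Each successor contributes exactly one [true] to the code of a number. *)
  have -> : count id (catrev (cword k) [::]) = k.
    by rewrite catrevE cats0 count_rev; elim: (k) => //= n {2}<-.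
  by run1 (@runs_mv 2 0).
have e : size (tword (code w)) = sz w by [].
have := @sz_size bool code_bool w; rewrite sz_pair /= ?size_rev -/(cword k) e -/(sz k); lia.
Qed.

Lemma runs_io (rho : word * nat -> word * nat) : ptime rho ->
  exists p c, forall w k, let r := rho (w, k) in
  runs p (regs [:: w; nseq k true]) (regs [:: r.1; nseq r.2 true]) ((size w + k).+2 ^ c).
Proof.
move=> pr; have rs := ptime_sz pr; case: pr => p [tau [pt prun]].
exists (Seq word_nat_to_code (Seq p word_nat_of_code)).
have : polyb (fun x : word * nat => size x.1 + x.2)
   (fun x => 20 * (size x.1 + x.2) + 20 + (tau x + 120 * sz (rho x))).
  have szb : polyb (fun x : word * nat => size x.1 + x.2) (fun x => sz x).
    apply: (@polyb_le _ _ (fun x : word * nat => 4 * (size x.1 + x.2) + 3)); first by polyb_tac.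
    case=> w k; rewrite sz_pair sz_nat /=.
    have : sz w <= 4 * size w + 1 by elim: w => // b w IH; rewrite sz_cons /=; have := @sz_bool b; lia.
    by lia.
  polyb_tac.
    exact: (polyb_comp (f := id) pt szb).
  exact: (polyb_comp (f := id) rs szb).
case=> c hc; exists c => w k /=; apply: runs_le (hc (w, k)) => /=.
apply: runs_seq (runs_word_nat_to_code w k) _.
apply: runs_seq (prun _) _.
by case: (rho (w, k)) => w' k' /=; apply: runs_word_nat_of_code.
Qed.

Definition clears (xs : seq nat) : prog := foldr (fun x q => Seq (clear x) q) Skip xs.

Lemma runs_clears xs s M : (forall x, size (s x) <= M) ->
  runs (clears xs) s (fun y => if y \in xs then [::] else s y) (size xs * (4 * M + 1) + 1).
Proof.
elim: xs s => [|x xs IH] s sM /=; first exact: runs_skip.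
rewrite mulSn -addnA; apply: runs_seq.
  by apply: runs_le (runs_clear x s) _; rewrite leq_add2r leq_mul2l sM.
apply: runs_to; first apply: IH.
  by move=> y; rewrite /upd; case: eqP.
apply: functional_extensionality => y; rewrite /upd inE.
by case: (y == x) => //=; case: (y \in xs).
Qed.

(** [outputs] constrains stacks 0 and 1 only, whereas the next program expects all other stacks to
    be empty. *)
Definition clean (p : prog) : prog := Seq p (clears (iota 2 (nstacks p))).

Lemma input_regs w k : input w k = regs [:: w; nseq k true].
Proof. by apply: functional_extensionality => -[|[|y]] //=; rewrite /regs /= nth_nil. Qed.

Lemma runs_clean p w k s t w' k' :
  exec p (input w k) s t -> outputs s w' k' ->
  runs (clean p) (regs [:: w; nseq k true]) (regs [:: w'; nseq k' true])
    (t + (nstacks p * (4 * (size w + k + t) + 1) + 1)).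
Proof.
rewrite input_regs => ex [s0 s1]; apply: runs_seq; first by exists t; first exact: ex.
have := @runs_clears (iota 2 (nstacks p)) s (size w + k + t); rewrite size_iota => cl.
apply: runs_to; first apply: cl.
  move=> x; apply: leq_trans (exec_growth ex x) _; rewrite leq_add2r.
  by case: x => [|[|x]]; rewrite /regs /= ?nth_nil ?size_nseq ?leq_addr ?leq_addl.
apply: functional_extensionality => -[|[|y]]; rewrite mem_iota /= -?s0 -?s1 //.
case: ifP; rewrite /regs /= nth_nil // => /negbT; rewrite -leqNgt => h.
by rewrite (exec_frame ex) /regs //= ?nth_nil //; lia.
Qed.

Lemma runs_save k : runs (Seq (mv 1 2) (Seq (mv2 2 0 3) (mv 3 2)))
  (regs [:: [::]; nseq k true]) (regs [:: nseq k true; [::]; nseq k true]) (13 * k + 3).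
Proof.
have rn : rev (nseq k true) = nseq k true by apply: rev_nseq.
eapply runs_le.
  run (@runs_mv 1 2); rewrite rn; run (@runs_mv2 2 0 3); rewrite rn.
  eapply runs_to; first by apply: (@runs_mv 3 2).
  by regs_norm; rewrite ?catrevE ?cats0 ?rn; regs_fin.
by rewrite /= ?size_nseq; lia.
Qed.

(** Computing [f k] consumes [k], so a copy of [k] is set aside first: the bounds for composed
    reductions involve [k] and [f k] together. *)
Lemma computable_ptime (f : nat -> nat) (rho : word * nat -> word * nat) :
  computable f -> ptime rho -> computable (fun k => (rho (nseq k true, f k)).2).
Proof.
move=> [p fp] /runs_io[q [c qr]].
exists (Seq (Seq (mv 1 2) (Seq (mv2 2 0 3) (mv 3 2)))
  (Seq (shift 1 (clean p)) (Seq (clear 1) (Seq (mv 2 1) q)))) => k.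
have [s [w [t [ex out]]]] := fp k.
have : exists T, runs (Seq (Seq (mv 1 2) (Seq (mv2 2 0 3) (mv 3 2)))
  (Seq (shift 1 (clean p)) (Seq (clear 1) (Seq (mv 2 1) q)))) (input [::] k)
    (regs [:: (rho (nseq k true, f k)).1; nseq (rho (nseq k true, f k)).2 true]) T.
  eexists; rewrite input_regs.
  eapply runs_seq; first exact: runs_save.
  eapply runs_seq; first by apply: runs_shift1; apply: runs_clean ex out.
  run (@runs_clear 1); eapply runs_seq.
    by apply: (@runs_mv 2 1).
  have -> : upd (upd (regs [:: nseq k true; [::]; nseq (f k) true]) 2 [::]) 1
      (rev (regs [:: nseq k true; [::]; nseq (f k) true] 2) ++
       regs [:: nseq k true; [::]; nseq (f k) true] 1) = regs [:: nseq k true; nseq (f k) true].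
    rewrite !upd_regs /= cats0 (_ : rev _ = nseq (f k) true); first by regs_fin.
    exact: rev_nseq.
  exact: qr.
case=> T [t' ex' _]; eexists _, _, t'; split; first exact: ex'.
by split.
Qed.

Lemma ptime_add A {cA : Code A} (f g : A -> nat) :
  ptime f -> ptime g -> ptime (fun a => f a + g a).
Proof.
move=> pf pg; apply: (ptime_ext (f := fun a => size (nseq (f a) tt ++ nseq (g a) tt))) => [|a].
  by apply: ptime_size; apply: ptime_cat; apply: ptime_nseq_unit.
by rewrite size_cat !size_nseq.
Qed.

Lemma ptime_mul A {cA : Code A} (f g : A -> nat) :
  ptime f -> ptime g -> ptime (fun a => f a * g a).
Proof.
move=> pf pg; apply: (ptime_ext (f := fun a => size [seq tt | _ <- nseq (f a) tt, _ <- nseq (g a) tt])) => [|a].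
  apply: ptime_size; apply: (ptime_allpairs (h := fun _ _ _ => tt)); last exact: ptime_const.
    exact: ptime_nseq_unit.
  exact: ptime_nseq_unit.
by rewrite size_allpairs !size_nseq.
Qed.

Lemma ptime_exp A {cA : Code A} (f : A -> nat) e : ptime f -> ptime (fun a => f a ^ e).
Proof.
move=> pf; elim: e => [|e IH]; first exact: (ptime_const 1).
by apply: (ptime_ext (ptime_mul pf IH)) => a; rewrite expnS.
Qed.

Lemma computable_poly (f : nat -> nat) b e :
  computable f -> computable (fun k => (k + f k + b) ^ e).
Proof.
move=> cf; have := @computable_ptime f (fun x => ([::], (size x.1 + x.2 + b) ^ e)) cf.
case=> [|p hp]; last by exists p => k; have := hp k; rewrite /= size_nseq.
apply: ptime_pair; first exact: ptime_const.
apply: ptime_exp; apply: ptime_add; last exact: ptime_const.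
by apply: ptime_add; [apply: ptime_size; apply: ptime_fst|apply: ptime_snd].
Qed.

(** The intermediate instance is no larger than the input plus the time spent on it. A polynomial in
    [f k * (size (enc x)).+1 ^ c] again splits into a function of [k] times a power of the input
    size. *)
Lemma fpt_reducible_ptime (A B C : problem) (rho : word * nat -> word * nat) (e : nat) :
  fpt_reducible A B -> ptime rho ->
  (forall (y : inst B) k, exists z : inst C,
     [/\ (rho (enc y, k)).1 = enc z, (rho (enc y, k)).2 <= (k + 2) ^ e &
         yes y k <-> yes z (rho (enc y, k)).2]) ->
  fpt_reducible A C.
Proof.
case=> p [f [g [c [cf cg red]]]] /runs_io[q [c1 qr]] corr.
have [c2 hc2] : exists c2, forall n w' k', size w' + k' <= 2 * n ->
    n + (nstacks p * (4 * n + 1) + 1) + (size (w' : word) + k').+2 ^ c1 <= n.+2 ^ c2.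
  have : polyb id (fun n => n + (nstacks p * (4 * n + 1) + 1) + (2 * n).+2 ^ c1).
    by polyb_tac; exact: polyb_mul (polyb_const _ _) (polyb_id _).
  case=> c2 h; exists c2 => n w' k' le; apply: leq_trans (h n).
  by rewrite leq_add2l; case: (c1) => // c'; rewrite leq_exp2r.
exists (Seq (clean p) q), (fun k => (k + f k + 2) ^ c2), (fun k => (k + g k + 2) ^ e), (c.+1 * c2).
split; try exact: computable_poly.
move=> x k; have [y [k' [s [t [[ex out] tle kle yx]]]]] := red x k.
have [z [ez kz yz]] := corr y k'.
have := runs_seq (runs_clean ex out) (qr (enc y) k').
rewrite -input_regs; case=> t' ex' t'le.
exists z, (rho (enc y, k')).2, (regs [:: (rho (enc y, k')).1; nseq (rho (enc y, k')).2 true]), t'.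
split; last by rewrite yx.
- by split=> //; split.
- apply: leq_trans t'le _.
  set n := size (enc x) + k + t.
  have le2 : size (enc y) + k' <= 2 * n.
    have := exec_growth ex 0; have := exec_growth ex 1.
    case: out => -> ->; rewrite /input /= !size_nseq /n; lia.
  apply: (leq_trans (_ : _ <= n.+2 ^ c2)).
    apply: leq_trans (hc2 n _ _ le2); rewrite leq_add2r leq_add2r /n; lia.
  (* What remains is [n.+2 <= (k + f k + 2) * (size (enc x)).+1 ^ c.+1]; the extra factor of the
     exponent [c.+1] absorbs the summand [size (enc x)] of [n]. *)
  rewrite expnM -expnMn; case: (c2) => // c2'; rewrite leq_exp2r //.
  rewrite /n expnS; have := expn_gt0 (size (enc x)).+1 c; rewrite /= => pos.
  move: tle pos; move: (f k) => F; move: (_ ^ c) => N; move: (size _) => m tle pos.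
  have h1 : m.+1 <= m.+1 * N by rewrite leq_pmulr.
  have h2 : F * N <= F * (m.+1 * N) by rewrite leq_mul2l leq_pmull ?orbT.
  have h3 : k <= k * (m.+1 * N) by rewrite leq_pmulr // muln_gt0.
  rewrite !mulnDl; lia.
- apply: leq_trans kz _; case: (e) => // e'; rewrite leq_exp2r //; lia.
Qed.

(** * Three-valued evaluation of circuits *)

(** A gate as a tuple: [(false, (_, [:: i]))] is a negation and [(true, (b, s))]
    the disjunction ([b = true]) or conjunction ([b = false]) over [s], so that
    [b] is the dominating value. *)
Definition gcode : Type := bool * (bool * seq nat).

Definition code_gate (g : gate) : gcode :=
  match g with
  | Not i => (false, (false, [:: i]))
  | And s => (true, (false, s))
  | Or s => (true, (true, s))
  end.

(** Kleene evaluation, except that a large gate with no dominating input known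
    takes the other value by default. *)
Definition kleene_gate (v : seq (option bool)) (g : gcode) : option bool :=
  if g.1 then
    if has (fun i => nth None v i == Some g.2.1) g.2.2 then Some g.2.1
    else if (2 < size g.2.2) || all (fun i => nth None v i == Some (~~ g.2.1)) g.2.2
      then Some (~~ g.2.1)
    else None
  else omap negb (nth None v (head 0 g.2.2)).

Definition kleene_eval (a : seq (option bool)) (gs : seq gcode) (out : nat) : option bool :=
  nth None (foldl (fun v g => rcons v (kleene_gate v g)) a gs) out.

Section NodeValues.
Variables (T : Type) (G : Type) (op : seq T -> G -> T) (x0 : T) (g0 : G).

Let run a gs := foldl (fun v g => rcons v (op v g)) a gs.

Lemma size_run a gs : size (run a gs) = size a + size gs.
Proof.
by elim: gs a => [|g gs IH] a /=; rewrite ?addn0 // /run /= -/(run _ _) IH size_rcons addSnnS.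
Qed.

Lemma run_cat a g1 g2 : run a (g1 ++ g2) = run (run a g1) g2.
Proof. exact: foldl_cat. Qed.

Lemma take_run a gs : take (size a) (run a gs) = a.
Proof.
elim: gs a => [|g gs IH] a; first exact: take_size.
rewrite /run /= -/(run _ _); have := IH (rcons a (op a g)); rewrite size_rcons => e.
rewrite -[in RHS](take_size a) -(take_takel _ (leqnSn (size a))) e -cats1.
by rewrite take_cat ltnn subnn take0 cats0 take_size.
Qed.

Lemma nth_run_input a gs j : j < size a -> nth x0 (run a gs) j = nth x0 a j.
Proof. by move=> h; rewrite -{2}(take_run a gs) nth_take. Qed.

(** The single recursion equation behind Boolean values, depth, weft and three-valued values
    alike. *)
Lemma nth_run_gate a gs i : i < size gs ->
  nth x0 (run a gs) (size a + i) = op (take (size a + i) (run a gs)) (nth g0 gs i).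
Proof.
move=> lt; rewrite -{1 2}(cat_take_drop i gs) run_cat (drop_nth g0) //.
rewrite [run _ (_ :: _)]/run /= -/(run _ _).
set b := run a (take i gs).
have sb : size b = size a + i by rewrite size_run size_takel // ltnW.
rewrite nth_run_input ?size_rcons ?sb // nth_rcons sb ltnn eqxx.
congr op; rewrite -sb -(take_takel _ (leqnSn (size b))).
have := take_run (rcons b (op b (nth g0 gs i))) (drop i.+1 gs).
by rewrite size_rcons => ->; rewrite -cats1 take_cat ltnn subnn take0 cats0.
Qed.
End NodeValues.

Lemma gate_evalE (v : seq bool) (g : gate) :
  gate_eval v g = let c := code_gate g in
    if c.1 then if has (fun i => nth false v i == c.2.1) c.2.2 then c.2.1 else ~~ c.2.1
    else ~~ nth false v (head 0 c.2.2).
Proof.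
case: g => [i|s|s] //=.
  have -> : has (fun i => nth false v i == false) s = ~~ all (nth false v) s.
    by rewrite -has_predC; apply: eq_has => i /=; case: (nth _ _ _).
  by case: all.
by rewrite (@eq_has _ _ (nth false v)) => [|i]; [case: has|case: (nth _ _ _)].
Qed.

Section Locality.
Variables (C : circuit) (a : seq bool).
Hypotheses (C_wf : circuit_wf C) (size_a : size a = ninputs C).

Let n := ninputs C.
Let m := size (gates C).
Let gt i := nth (And [::]) (gates C) i.
Let value j := nth false (node_values gate_eval a C) j.
Let dep j := nth 0 (node_values (fun v g => (\max_(i <- preds g) nth 0 v i).+1)
                     (nseq (ninputs C) 0) C) j.
Let wft j := nth 0 (node_values
           (fun v g => (2 < size (preds g)) + \max_(i <- preds g) nth 0 v i)
           (nseq (ninputs C) 0) C) j.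
Let tri P j := nth None (foldl (fun v g => rcons v (kleene_gate v g)) P
                     (map code_gate (gates C))) j.

Definition consistent (P : seq (option bool)) : Prop :=
  size P = n /\ forall i, i < n -> nth None P i = None \/ nth None P i = Some (nth false a i).

Definition knows (P : seq (option bool)) (F : seq nat) : Prop :=
  forall i, i \in F -> nth None P i = Some (nth false a i).

Lemma preds_lt i : i < m -> all (fun j => j < n + i) (preds (gt i)).
Proof.
move=> lt; case/andP: C_wf => _ /allP/(_ i); rewrite mem_iota add0n lt => /(_ isT).
by case/andP.
Qed.

Lemma preds_code g : (code_gate g).2.2 = preds g.
Proof. by case: g. Qed.

Lemma value_gate i : i < m -> value (n + i) = gate_eval (node_values gate_eval a C) (gt i).
Proof.
move=> lt; rewrite /value /n -size_a.
rewrite (nth_run_gate _ _ (And [::])) // !gate_evalE /= size_a -/n -/(gt i) !preds_code.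
have /allP pl := preds_lt lt.
have e j : j \in preds (gt i) -> nth false (take (n + i) (node_values gate_eval a C)) j
   = nth false (node_values gate_eval a C) j by move=> /pl h; rewrite nth_take.
rewrite (@eq_in_has _ _ (fun j => nth false (node_values gate_eval a C) j == (code_gate (gt i)).2.1));
  last by move=> j /e ->.
case: (gt i) e => //= j e; by rewrite e ?inE.
Qed.

Lemma dep_gate i : i < m -> dep (n + i) = (\max_(j <- preds (gt i)) dep j).+1.
Proof.
move=> lt; rewrite /dep; have {1}-> : n = size (nseq n 0) by rewrite size_nseq.
rewrite (nth_run_gate _ _ (And [::])) // size_nseq; congr _.+1; apply: eq_big_seq => j.
by move=> /(allP (preds_lt lt)) h; rewrite nth_take.
Qed.

Lemma wft_gate i : i < m ->
  wft (n + i) = (2 < size (preds (gt i))) + \max_(j <- preds (gt i)) wft j.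
Proof.
move=> lt; rewrite /wft; have {1}-> : n = size (nseq n 0) by rewrite size_nseq.
rewrite (nth_run_gate _ _ (And [::])) // size_nseq; congr (_ + _); apply: eq_big_seq => j.
by move=> /(allP (preds_lt lt)) h; rewrite nth_take.
Qed.

Lemma tri_gate P i : size P = n -> i < m ->
  tri P (n + i) = let c := code_gate (gt i) in
    if c.1 then if has (fun j => tri P j == Some c.2.1) c.2.2 then Some c.2.1
      else if (2 < size c.2.2) || all (fun j => tri P j == Some (~~ c.2.1)) c.2.2
      then Some (~~ c.2.1) else None
    else omap negb (tri P (head 0 c.2.2)).
Proof.
move=> sP lt; rewrite /tri -{1}sP.
rewrite (nth_run_gate _ _ (code_gate (And [::]))) ?size_map // sP.
rewrite (nth_map (And [::])) // -/(gt i) /kleene_gate /=.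
have /allP pl := preds_lt lt; rewrite preds_code.
set V := foldl _ _ _.
have e j : j \in preds (gt i) -> nth None (take (n + i) V) j = nth None V j.
  by move=> /pl h; rewrite nth_take.
rewrite (@eq_in_has _ _ (fun j => nth None V j == Some (code_gate (gt i)).2.1)); last by move=> j /e ->.
rewrite (@eq_in_all _ _ (fun j => nth None V j == Some (~~ (code_gate (gt i)).2.1))); last by move=> j /e ->.
case: (gt i) e => //= j e; by rewrite e ?inE.
Qed.

Lemma input_value j : j < n -> value j = nth false a j.
Proof. by move=> h; rewrite /value nth_run_input // size_a. Qed.

Lemma input_tri P j : size P = n -> j < n -> tri P j = nth None P j.
Proof. by move=> sP h; rewrite /tri nth_run_input // sP. Qed.

Lemma pred_node i j : i < m -> j \in preds (gt i) -> j < n + i.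
Proof. by move=> lt /(allP (preds_lt lt)). Qed.

(** The default value is the only rule that can err, and it concerns large gates. At weft 0 no such
    gate is involved, and what is left is Kleene logic, which is never wrong. *)
Lemma tri_small P j : consistent P -> j < n + m -> wft j = 0 ->
  tri P j = None \/ tri P j = Some (value j).
Proof.
case=> sP cP; elim/ltn_ind: j => j IH jlt.
case: (ltnP j n) => [lt _|le w0].
  by rewrite input_tri // input_value //; apply: cP.
have ej : j = n + (j - n) by rewrite subnKC.
have ilt : j - n < m by rewrite ltn_subLR.
move: (j - n) ej ilt => i ej ilt; subst j.
move: w0; rewrite wft_gate // => /eqP; rewrite addn_eq0 eqb0 => /andP[/negbTE small /eqP mx].
have IHp k : k \in preds (gt i) -> tri P k = None \/ tri P k = Some (value k).
  move=> ki; have klt := pred_node ilt ki; apply: IH => //; first exact: ltn_trans klt jlt.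
  by apply/eqP; rewrite -leqn0 -mx; apply: (leq_bigmax_seq (F := wft)).
rewrite tri_gate // value_gate // gate_evalE /= preds_code small /=.
case c1: (code_gate (gt i)).1; last first.
  have : head 0 (preds (gt i)) \in preds (gt i) by case: (gt i) c1 => //= k; rewrite inE.
  by move=> /IHp[] -> /=; [left|right].
set b := (code_gate (gt i)).2.1.
case: ifP => [/hasP[k ki /eqP tk]|no].
  right; case: ifP => // /negbT/hasPn/(_ k ki); rewrite -/(value k).
  by case: (IHp k ki) => e; rewrite tk in e => //; case: e => ->; rewrite eqxx.
case: ifP => al; [right|by left].
case: ifP => // /hasP[k ki /eqP vk]; move/allP/(_ k ki)/eqP: al => tk.
by case: (IHp k ki); rewrite tk // => -[]; rewrite /value vk; case: (b).
Qed.

Lemma union_knows (s : seq nat) D :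
  (forall k, k \in s -> exists F, [/\ size F <= 2 ^ dep k, all (fun x => x < n) F &
     forall P, consistent P -> knows P F -> tri P k = Some (value k)]) ->
  (forall k, k \in s -> dep k <= D) ->
  exists F, [/\ size F <= size s * 2 ^ D, all (fun x => x < n) F &
    forall P, consistent P -> knows P F -> forall k, k \in s -> tri P k = Some (value k)].
Proof.
elim: s => [|k s IH] hs hd; first by exists [::].
have [F1 [s1 l1 k1]] := IH (fun k ks => hs k (mem_behead (s := _ :: _) ks))
  (fun k ks => hd k (mem_behead (s := _ :: _) ks)).
have [F2 [s2 l2 k2]] := hs k (mem_head _ _).
exists (F2 ++ F1); split.
- rewrite size_cat mulSn leq_add // (leq_trans s2) // leq_exp2l // hd // mem_head //.
- by rewrite all_cat l1 l2.
- move=> P cP kP j; rewrite inE => /orP[/eqP ->|].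
    by apply: k2 => // i iF; apply: kP; rewrite mem_cat iF.
  by apply: k1 => // i iF; apply: kP; rewrite mem_cat iF orbT.
Qed.

Lemma tri_certificate j : j < n + m -> wft j <= 1 ->
  exists F, [/\ size F <= 2 ^ dep j, all (fun x => x < n) F &
    forall P, consistent P -> knows P F -> tri P j = Some (value j)].
Proof.
elim/ltn_ind: j => j IH jlt.
case: (ltnP j n) => [lt _|le w1].
  exists [:: j]; split; rewrite /= ?expn_gt0 ?lt // => P [sP _] kP.
  by rewrite input_tri // input_value // kP ?inE.
have ej : j = n + (j - n) by rewrite subnKC.
have ilt : j - n < m by rewrite ltn_subLR.
move: (j - n) ej ilt => i ej ilt; subst j.
have klt k : k \in preds (gt i) -> k < n + m.
  by move=> /(pred_node ilt)/ltn_trans; apply.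
have lew k : k \in preds (gt i) -> wft k <= \max_(j <- preds (gt i)) wft j.
  by move=> ki; apply: (leq_bigmax_seq (F := wft)).
have led k : k \in preds (gt i) -> dep k <= \max_(j <- preds (gt i)) dep j.
  by move=> ki; apply: (leq_bigmax_seq (F := dep)).
move: w1; rewrite wft_gate // => w1.
have IHp k : k \in preds (gt i) -> exists F, [/\ size F <= 2 ^ dep k, all (fun x => x < n) F &
     forall P, consistent P -> knows P F -> tri P k = Some (value k)].
  move=> ki; apply: IH; [exact: pred_node|exact: klt|].
  by apply: leq_trans (lew k ki) _; apply: leq_trans w1; apply: leq_addl.
rewrite dep_gate //.
case c1: (code_gate (gt i)).1; last first.
  have hin : head 0 (preds (gt i)) \in preds (gt i) by case: (gt i) c1 => //= k; rewrite inE.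
  have [F [sF aF kF]] := IHp _ hin; exists F; split=> //.
    by apply: leq_trans sF _; rewrite leq_exp2l // ltnW // ltnS led.
  move=> P cP kP; rewrite tri_gate ?(proj1 cP) // value_gate // gate_evalE /= c1 preds_code.
  by rewrite (kF _ cP kP).
(* A small gate joins the certificates of its at most two inputs. This doubling per level is the
   origin of [2 ^ dep j]. *)
case large: (2 < size (preds (gt i))); last first.
  have [F [sF aF kF]] := union_knows IHp led.
  exists F; split=> //.
    apply: leq_trans sF _; rewrite expnS leq_mul2r; apply/orP; right.
    by rewrite leqNgt large.
  move=> P cP kP; rewrite tri_gate ?(proj1 cP) // value_gate // gate_evalE /= c1 preds_code large /=.
  set b := (code_gate (gt i)).2.1.
  rewrite (@eq_in_has _ _ (fun j => value j == b)); last by move=> k /(kF _ cP kP) ->.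
  case: ifP => // /negbT/hasPn no; rewrite ifT //.
  by apply/allP => k ki; rewrite (kF _ cP kP) //; move: (no k ki); case: (value k) (b) => [] [].
(* The gate itself uses up the weft, so [tri_small] applies to its inputs. If one of them dominates,
   its certificate alone decides the gate. *)
have w0 k : k \in preds (gt i) -> wft k = 0.
  by move: w1; rewrite large add1n ltnS leqn0 => /eqP mx /lew; rewrite mx leqn0 => /eqP.
have [/hasP[k ki /eqP vk]|/negbTE no] := boolP (has (fun j => value j == (code_gate (gt i)).2.1) (preds (gt i))).
  have [F [sF aF kF]] := IHp _ ki; exists F; split=> //.
    by apply: leq_trans sF _; rewrite leq_exp2l // ltnW // ltnS led.
  move=> P cP kP; rewrite tri_gate ?(proj1 cP) // value_gate // gate_evalE /= c1 preds_code.
  rewrite ifT; last by apply/hasP; exists k => //; rewrite (kF _ cP kP) vk.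
  by rewrite ifT //; apply/hasP; exists k => //; apply/eqP.
(* No input dominates, and by [tri_small] none is wrongly believed to do so: the default is the true
   value under every consistent assignment. *)
exists [::]; split=> // P cP _.
rewrite tri_gate ?(proj1 cP) // value_gate // gate_evalE /= c1 preds_code large /=.
have -> : has (fun j => tri P j == Some (code_gate (gt i)).2.1) (preds (gt i)) = false.
  apply/negbTE/hasPn => k ki; case: (tri_small cP (klt k ki) (w0 k ki)) => -> //.
  by move/negbT/hasPn/(_ k ki): no; apply: contra => /eqP[->].
by rewrite no.
Qed.

Theorem kleene_eval_certificate : weft C <= 1 ->
  exists F, [/\ size F <= 2 ^ depth C, all (fun x => x < ninputs C) F &
    forall P, consistent P -> knows P F ->
      kleene_eval P (map code_gate (gates C)) (outnode C) = Some (circuit_eval C a)].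
Proof. by move=> w1; case/andP: C_wf => olt _; apply: tri_certificate. Qed.

End Locality.

(** * Block decompositions and cliques *)

(** [(i, (l, r))] claims that, in the input word followed by a sentinel [true],
    the [i]-th maximal block of the form [false ... false true] occupies the
    positions [l], ..., [r - 1]. *)
Definition item : Type := nat * (nat * nat).

(** A block is a pair of claims about the map from cut indices to positions: cut [i] lies at [l] and
    cut [i + 1] at [r]. Blocks agree when the claims form a function. *)
Definition points (s : seq item) : seq (nat * nat) :=
  flatten [seq [:: (x.1, x.2.1); (x.1.+1, x.2.2)] | x <- s].

Definition functional (s : seq (nat * nat)) : bool :=
  all (fun x => all (fun y => (x.1 == y.1) ==> (x.2 == y.2)) s) s.

Definition items (n k : nat) : seq item :=
  [seq (i, lr) | i <- iota 0 k.+1, lr <- [seq (l, r) | l <- iota 0 n.+2, r <- iota 0 n.+2]].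

Fixpoint lists (T : Type) (q : nat) (s : seq T) : seq (seq T) :=
  if q is q'.+1 then [seq x :: l | x <- s, l <- lists q' s] else [:: [::]].

(** A block ends with its only [true], so a covered position holds a one exactly when it is the last
    of its block. The sentinel, at position [n], is outside the view. *)
Definition view (n : nat) (s : seq item) : seq (option bool) :=
  mkseq (fun m => if [seq x <- s | (x.2.1 <= m) && (m < x.2.2)] is x :: _
                  then Some (m.+1 == x.2.2) else None) n.

Definition label : Type := seq item * seq item.

(** The two added points anchor the first cut at 0 and the last one just behind the sentinel. *)
Definition valid (n k : nat) (gs : seq gcode) (out : nat) (p : label) : bool :=
  [&& functional ((0, 0) :: (k.+1, n.+1) :: points (p.1 ++ p.2)),
      all (fun x => x.2.1 < x.2.2) (p.1 ++ p.2) &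
      kleene_eval (view n (p.1 ++ p.2)) gs out == Some true].

(** Three copies of every label, since a connected set of the temporal graph yields a
    clique with up to two vertices fewer. *)
Definition vertices (q n k : nat) (gs : seq gcode) (out : nat) : seq (nat * label) :=
  [seq (c, p) | c <- iota 0 3,
                p <- [seq p <- [seq (h, v) | h <- lists q (items n k), v <- lists q (items n k)]
                     | valid n k gs out p]].

Definition compatible (p q : label) : bool :=
  (p.1 == q.1) && functional (points (p.1 ++ p.2 ++ q.2)).

Definition adj (u v : nat * label) : bool := (u != v) && compatible u.2 v.2.

Lemma functionalP (s : seq (nat * nat)) :
  reflect (forall x y, x \in s -> y \in s -> x.1 = y.1 -> x.2 = y.2) (functional s).
Proof.
apply: (iffP allP) => [h x y xs ys e|h x xs].
  by have /allP/(_ _ ys) := h x xs; rewrite e eqxx => /eqP.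
by apply/allP => y ys; apply/implyP => /eqP e; apply/eqP; apply: h.
Qed.

Lemma functional_sub s1 s2 : {subset s1 <= s2} -> functional s2 -> functional s1.
Proof. by move=> sub /functionalP f; apply/functionalP => x y /sub xs /sub; apply: f. Qed.

Lemma mem_points (s : seq item) x : x \in s -> (x.1, x.2.1) \in points s /\ (x.1.+1, x.2.2) \in points s.
Proof.
by move=> xs; split; apply/flattenP; exists [:: (x.1, x.2.1); (x.1.+1, x.2.2)];
  rewrite ?inE ?eqxx ?orbT //; apply: map_f.
Qed.

Lemma pointsP (s : seq item) z : z \in points s ->
  exists2 x, x \in s & z = (x.1, x.2.1) \/ z = (x.1.+1, x.2.2).
Proof.
by case/flattenP => l /mapP[x xs ->]; rewrite !inE => /orP[]/eqP ->; exists x => //; [left|right].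
Qed.

Lemma points_sub (s1 s2 : seq item) : {subset s1 <= s2} -> {subset points s1 <= points s2}.
Proof.
by move=> sub z /pointsP[x /sub xs [] ->]; have [] := mem_points xs.
Qed.

Lemma adj_irr : irreflexive adj.
Proof. by move=> u; rewrite /adj eqxx. Qed.

Lemma size_lists (T : Type) q (s : seq T) : size (lists q s) = size s ^ q.
Proof. by elim: q => // q IH; rewrite /= size_allpairs IH expnS. Qed.

Lemma mem_lists (T : eqType) q (s : seq T) l :
  (l \in lists q s) = (size l == q) && all (fun x => x \in s) l.
Proof.
elim: q l => [|q IH] l /=; first by rewrite inE; case: l.
apply/allpairsP/idP => [[[x l'] /= [xs ls ->]]|].
  by move: ls; rewrite IH => /andP[/eqP <- al] /=; rewrite eqxx xs.
case: l => // x l /= /andP[]; rewrite eqSS => sl /andP[xs al].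
by exists (x, l); split=> //=; rewrite IH sl.
Qed.

Lemma uniq_lists (T : eqType) q (s : seq T) : uniq s -> uniq (lists q s).
Proof.
move=> us; elim: q => //= q IH; apply: allpairs_uniq => //.
by move=> [x l] [y l'] _ _ [-> ->].
Qed.

Lemma mem_items n k (x : item) :
  (x \in items n k) = [&& x.1 <= k, x.2.1 <= n.+1 & x.2.2 <= n.+1].
Proof.
case: x => i [l r]; apply/allpairsP/idP => [[[i' lr] [hi /allpairsP[[l' r'] [hl hr e]] e']]|].
  move: e' hi hl hr; rewrite e => -[-> -> ->].
  by rewrite !mem_iota !add0n !ltnS !leq0n /= => -> -> ->.
move=> /and3P[hi hl hr]; exists (i, (l, r)); split; rewrite ?mem_iota //.
by apply/allpairsP; exists (l, r); split; rewrite ?mem_iota.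
Qed.

Lemma uniq_items n k : uniq (items n k).
Proof.
apply: allpairs_uniq; rewrite ?iota_uniq //; last by move=> [? ?] [? ?] _ _ [-> ->].
by apply: allpairs_uniq; rewrite ?iota_uniq // => -[? ?] [? ?] _ _ [-> ->].
Qed.

Lemma uniq_vertices q n k gs out : uniq (vertices q n k gs out).
Proof.
apply: allpairs_uniq; rewrite ?iota_uniq //; last by move=> [? ?] [? ?] _ _ [-> ->].
apply: filter_uniq; apply: allpairs_uniq; rewrite ?uniq_lists ?uniq_items //.
by move=> [? ?] [? ?] _ _ [-> ->].
Qed.

Lemma mem_vertices q n k gs out (u : nat * label) :
  (u \in vertices q n k gs out) =
  [&& u.1 < 3, u.2.1 \in lists q (items n k), u.2.2 \in lists q (items n k) & valid n k gs out u.2].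
Proof.
case: u => c [h v]; apply/allpairsP/idP => [[[c' p] [mc mp]]|/and4P[/= hc hh hv va]].
  move: mp; rewrite mem_filter => /andP[va /allpairsP[[h1 v1] [m1 m2 /= ep]]] /= [-> e].
  by move: va mc; rewrite mem_iota /= -e => -> ->; move: ep m1 m2; rewrite -e => -[-> ->] /= -> ->.
exists (c, (h, v)); split; [by rewrite /= (mem_iota 0 3 c)|rewrite mem_filter va /=|by []].
by apply/allpairsP; exists (h, v).
Qed.

(** * Inputs of weight [k] as sequences of cuts *)

Section Cuts.
Variables (n k : nat).

(** Besides 0, there is one cut right behind each of the [k] ones and one behind the sentinel. *)
Definition cuts (c : seq nat) : Prop :=
  [/\ sorted ltn c, size c = k.+2, nth 0 c 0 = 0 & nth 0 c k.+1 = n.+1].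

Definition input_of_cuts (c : seq nat) : seq bool := mkseq (fun m => m.+1 \in c) n.

Definition block (c : seq nat) (i : nat) : item := (i, (nth 0 c i, nth 0 c i.+1)).

Definition ones (f : pred nat) : seq nat := [seq i.+1 | i <- iota 0 n.+1 & f i].

Lemma sorted_ones f : sorted ltn (ones f).
Proof.
rewrite sorted_map; apply: (sorted_filter (leT := fun x y => x.+1 < y.+1)).
  by move=> x y z; rewrite /= !ltnS; apply: ltn_trans.
exact: iota_ltn_sorted.
Qed.

Lemma nth_cuts_lt c i j : cuts c -> i < j -> j < k.+2 -> nth 0 c i < nth 0 c j.
Proof.
case=> sc zc _ _ ij jk; apply: (sorted_ltn_nth ltn_trans) => //.
  by rewrite inE zc (ltn_trans ij).
by rewrite inE zc.
Qed.

Lemma nth_cuts_le c i : cuts c -> i < k.+2 -> nth 0 c i <= n.+1.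
Proof.
move=> cc; rewrite ltnS leq_eqVlt => /orP[/eqP ->|lt]; first by case: cc => _ _ _ ->.
by apply: ltnW; case: (cc) => _ _ _ <-; apply: nth_cuts_lt.
Qed.

(** Strictly sorted lists with the same members are equal. Counting the cuts thereby counts the
    ones, plus the sentinel. *)
Lemma behead_cuts c : cuts c -> behead c = ones (fun m => m.+1 \in c).
Proof.
move=> cc; apply: (@irr_sorted_eq _ ltn); rewrite ?sorted_ones //.
- exact: ltn_trans.
- exact: ltnn.
- by case: cc => sc _ _ _; case: (c) sc => // x s /path_sorted.
move=> x; case: (cc) => sc zc c0 cl; apply/idP/mapP => [xb|[i]]; last first.
  rewrite mem_filter => /andP[ic _ ->]; case: (c) c0 ic => //= y s ->.
  by rewrite inE.
have xc : x \in c by apply: mem_behead.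
have xle : x <= n.+1.
  by rewrite -(nth_index 0 xc); apply: nth_cuts_le => //; rewrite -zc index_mem.
have x0 : 0 < x.
  case: (c) c0 sc xb => //= y s -> p xs; have := order_path_min ltn_trans p.
  by move/allP/(_ x xs).
exists x.-1; last by rewrite prednK.
by rewrite mem_filter prednK // xc mem_iota /=; case: (x) x0 xle.
Qed.

Lemma count_input_of_cuts c : cuts c -> count id (input_of_cuts c) = k.
Proof.
move=> cc; case: (cc) => _ zc _ cl; apply/eqP; rewrite -eqSS; apply/eqP.
have := behead_cuts cc => /(congr1 size); rewrite size_behead zc /ones size_map size_filter [_.-1]/= => ->.
rewrite /input_of_cuts /mkseq count_map -[n.+1]addn1 iotaD count_cat /= add0n addn0.
have -> : n.+1 \in c by rewrite -cl mem_nth // zc.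
by rewrite addn1; congr _.+1; apply: eq_count.
Qed.

Lemma cuts_of_input a : size a = n -> count id a = k ->
  exists2 c, cuts c & input_of_cuts c = a.
Proof.
(* At position [n], the default [true] of [nth] plays the sentinel. *)
move=> sa ca; pose c := 0 :: ones (nth true a).
have zc : size (ones (nth true a)) = k.+1.
  rewrite /ones size_map size_filter -[n.+1]addn1 iotaD count_cat /= add0n addn0.
  rewrite nth_default ?sa // addn1 -ca -{2}(mkseq_nth true a) /mkseq count_map sa.
  by congr _.+1; apply: eq_count.
have mc m : m <= n -> (m.+1 \in c) = nth true a m.
  move=> mn; rewrite inE /=; apply/mapP/idP => [[i]|h].
    by rewrite mem_filter => /andP[ai _] [->].
  by exists m => //; rewrite mem_filter h mem_iota.
have sl : sorted ltn c.
  by rewrite /c /= path_min_sorted ?sorted_ones //; apply/allP => x /mapP[i _ ->].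
exists c; last first.
  apply: (@eq_from_nth _ true); first by rewrite size_mkseq.
  by move=> i; rewrite size_mkseq => lt; rewrite nth_mkseq // mc // ltnW.
split=> //; last 1 first.
- have : n.+1 \in c by rewrite mc // nth_default ?sa.
  have le x : x \in c -> x <= n.+1.
    rewrite inE => /orP[/eqP -> //|/mapP[i]].
    by rewrite mem_filter mem_iota => /andP[_] /andP[_ h] ->.
  have sc : sorted leq c.
    apply: (sub_sorted (e := ltn)) => [x y /ltnW //|].
    exact: sl.
  have szc : size c = k.+2 by rewrite /= zc.
  move=> /(nthP 0)[j jl e]; apply/eqP; rewrite eqn_leq le ?mem_nth ?szc // -{1}e.
  by apply: (sorted_leq_nth leq_trans leqnn) => //; rewrite ?inE ?szc // -ltnS -szc.
- by rewrite /= zc.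
Qed.

Lemma block_truth c i m : cuts c -> i <= k -> m < n -> nth 0 c i <= m < nth 0 c i.+1 ->
  nth false (input_of_cuts c) m = (m.+1 == nth 0 c i.+1).
Proof.
move=> cc ik mn /andP[le lt]; rewrite nth_mkseq //; case: (cc) => sc zc _ _.
apply/idP/eqP => [mc|->]; last by rewrite mem_nth // zc.
(* A one before the end of the block would put a cut strictly between two consecutive cuts. *)
apply/eqP; rewrite eqn_leq lt /= leqNgt; apply/negP => lt2.
set j := index m.+1 c; have ej : nth 0 c j = m.+1 by apply: nth_index.
have jl : j < k.+2 by rewrite -zc index_mem.
case: (ltngtP i j) => [ij|ji|e]; last by move: le; rewrite e ej ltnn.
  case: (ltngtP i.+1 j) => [h|h|h]; last by move: lt2; rewrite h ej ltnn.
    by have := nth_cuts_lt cc h jl; rewrite ej => /(ltn_trans lt2); rewrite ltnn.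
  by move: h; rewrite ltnS leqNgt ij.
have := nth_cuts_lt cc ji (leq_trans ik (leqnSn _)); rewrite ej => h.
by have := leq_trans h le; rewrite ltnNge leqnSn.
Qed.

Lemma block_cover c m : cuts c -> m < n -> exists2 i, i <= k & nth 0 c i <= m < nth 0 c i.+1.
Proof.
move=> cc mn; case: (cc) => sc zc c0 cl.
have hs : has (fun x => m < x) c.
  by apply/hasP; exists n.+1; [rewrite -cl mem_nth ?zc | apply: leq_trans mn _].
set j := find (fun x => m < x) c.
have jl : j < k.+2 by rewrite -zc -has_find.
have mj : m < nth 0 c j by have := nth_find 0 hs.
have j0 : 0 < j by case: (j) mj => //; rewrite c0.
exists j.-1; first by rewrite -ltnS prednK.
rewrite prednK // mj andbT leqNgt.
have lt : j.-1 < j by rewrite prednK.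
by rewrite (before_find 0 lt).
Qed.

(** [view] reads the first item covering [m], possibly another one than [x]; as all items are
    genuine blocks, any of them tells the truth. *)
Lemma view_knows_item c (s : seq item) x m : cuts c ->
  (forall x, x \in s -> x.1 <= k /\ x = block c x.1) ->
  m < n -> x \in s -> x.2.1 <= m < x.2.2 ->
  nth None (view n s) m = Some (nth false (input_of_cuts c) m).
Proof.
move=> cc hs mn xs xm; rewrite nth_mkseq //.
have : x \in [seq x <- s | (x.2.1 <= m) && (m < x.2.2)] by rewrite mem_filter xm.
case e: [seq x <- s | _] => [|y l] // _.
have : y \in [seq x <- s | (x.2.1 <= m) && (m < x.2.2)] by rewrite e mem_head.
rewrite mem_filter => /andP[ym ys]; have [yk ye] := hs y ys.
by rewrite ye (block_truth (i := y.1)) //; move: ym; rewrite ye.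
Qed.

End Cuts.

(** * Weighted satisfiability as a clique problem *)

Section Clique.
Variables (C : circuit) (k q : nat).
Hypotheses (C_wf : circuit_wf C) (C_weft : weft C <= 1) (C_depth : 2 ^ depth C <= q).

Let n := ninputs C.
Let gs := map code_gate (gates C).
Let out := outnode C.
Let P := vertices q n k gs out.
Let N := k.+1 ^ q.

Lemma view_consistent c (s : seq item) : cuts n k c ->
  (forall x, x \in s -> x.1 <= k /\ x = block c x.1) ->
  consistent C (input_of_cuts n c) (view n s).
Proof.
move=> cc hs; split; first by rewrite size_mkseq.
move=> m mn; case h: (has (fun x => x.2.1 <= m < x.2.2) s).
  by case/hasP: h => x xs xm; right; apply: (view_knows_item (k := k)) xm.
left; rewrite nth_mkseq //; move/negbT: h; rewrite has_filter negbK => /eqP e.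
by rewrite e.
Qed.

Lemma cover_positions c (F : seq nat) : cuts n k c -> size F <= q -> all (fun x => x < n) F ->
  exists J, [/\ size J = q, all (fun i => i <= k) J &
    forall m, m \in F -> exists2 i, i \in J & nth 0 c i <= m < nth 0 c i.+1].
Proof.
move=> cc sF /allP aF; have [J [sJ aJ cJ]] : exists J, [/\ size J = size F, all (fun i => i <= k) J &
    forall m, m \in F -> exists2 i, i \in J & nth 0 c i <= m < nth 0 c i.+1].
  elim: F aF {sF} => [|m F IH] aF; first by exists [::].
  have [J [sJ aJ cJ]] := IH (fun x xF => aF x (mem_behead (s := _ :: _) xF)).
  have [i ik im] := block_cover cc (aF m (mem_head _ _)).
  exists (i :: J); split; rewrite /= ?sJ ?ik //.
  move=> m'; rewrite inE => /orP[/eqP ->|/cJ[j jJ jm]]; first by exists i; rewrite ?mem_head.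
  by exists j; rewrite // inE jJ orbT.
(* Labels have lists of length exactly [q]; index 0 is always available as padding. *)
exists (J ++ nseq (q - size F) 0); split.
- by rewrite size_cat size_nseq sJ subnKC.
- by rewrite all_cat aJ all_nseq orbT.
- by move=> m /cJ[i iJ im]; exists i; rewrite // mem_cat iJ.
Qed.

Lemma blocks_functional c (s : seq item) : cuts n k c ->
  (forall x, x \in s -> x.1 <= k /\ x = block c x.1) ->
  functional ((0, 0) :: (k.+1, n.+1) :: points s).
Proof.
move=> [_ _ c0 cl] hs.
have pt z : z \in (0, 0) :: (k.+1, n.+1) :: points s -> z.2 = nth 0 c z.1.
  rewrite !inE => /or3P[/eqP -> //|/eqP -> //|/pointsP[x xs]].
  by have [_ e] := hs x xs; rewrite e => -[] ->.
by apply/functionalP => x y /pt -> /pt -> ->.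
Qed.

Lemma map_block_known c J : all (fun i => i <= k) J ->
  forall x, x \in map (block c) J -> x.1 <= k /\ x = block c x.1.
Proof. by move=> /allP aJ x /mapP[i /aJ ik ->]. Qed.

Lemma map_fst_block c J : map fst (map (block c) J) = J.
Proof. by rewrite -map_comp map_id_in. Qed.

Lemma map_block_lists c J : cuts n k c -> size J = q -> all (fun i => i <= k) J ->
  map (block c) J \in lists q (items n k).
Proof.
move=> cc sJ /allP aJ; rewrite mem_lists size_map sJ eqxx /=.
apply/allP => x /mapP[i /aJ ik ->]; rewrite mem_items /= ik.
by rewrite !(nth_cuts_le cc) // ltnS ltnW.
Qed.

Theorem clique_of_sat : has_sat_of_weight C k ->
  exists W : seq (nat * label), [/\ uniq W, {subset W <= P}, size W = 3 * N &
    {in W &, forall u v, u != v -> adj u v}].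
Proof.
case=> a [ca ea]; have [c cc ec] := cuts_of_input (size_tuple a) ca.
have [F [sF aF kF]] := kleene_eval_certificate C_wf (size_tuple a) C_weft.
have [J0 [sJ0 aJ0 cJ0]] := cover_positions cc (leq_trans sF C_depth) aF.
pose h := map (block c) J0.
pose mk (b : nat) J : nat * label := (b, (h, map (block c) J)).
have known J : all (fun i => i <= k) J ->
    forall x, x \in h ++ map (block c) J -> x.1 <= k /\ x = block c x.1.
  move=> aJ x; rewrite mem_cat => /orP[]; exact: map_block_known.
(* All labels share the list [h] covering the certificate [F], so they evaluate to true for every
   [J]. *)
exists [seq mk b J | b <- iota 0 3, J <- lists q (iota 0 k.+1)].
have mJ J : J \in lists q (iota 0 k.+1) -> size J = q /\ all (fun i => i <= k) J.
  rewrite mem_lists => /andP[/eqP -> aJ]; split=> //.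
  by apply: sub_all aJ => i; rewrite mem_iota.
split.
- apply: allpairs_uniq; rewrite ?iota_uniq ?uniq_lists ?iota_uniq //.
  by move=> [b J] [b' J'] _ _ [-> /(congr1 (map fst))]; rewrite !map_fst_block => ->.
- move=> u /allpairsP[[b J] [hb /mJ[sJ aJ] ->]]; rewrite mem_vertices.
  have -> : (mk b J).1 < 3 by move: hb; rewrite (mem_iota 0 3 b).
  rewrite !map_block_lists //= /valid; apply/and3P; split.
  + exact: blocks_functional cc (known J aJ).
  + apply/allP => x /(known J aJ)[xk ->] /=.
    by apply: (nth_cuts_lt cc).
  + rewrite kF ?ea // -ec; first exact: view_consistent (known J aJ).
    move=> m mF; have [i iJ im] := cJ0 m mF.
    apply: (view_knows_item (k := k) (x := block c i)) im => //.
    * exact: (known J aJ).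
    * exact: (allP aF).
    * by rewrite mem_cat map_f.
- by rewrite size_allpairs size_lists !size_iota.
move=> u v /allpairsP[[b J] [_ /mJ[_ aJ] ->]] /allpairsP[[b' J'] [_ /mJ[_ aJ'] ->]] ne.
rewrite /adj ne /compatible eqxx /=.
apply: (functional_sub (s2 := (0, 0) :: (k.+1, n.+1) :: points (h ++ map (block c) J ++ map (block c) J'))).
  by move=> z; rewrite !inE => ->; rewrite !orbT.
apply: blocks_functional cc _ => x; rewrite catA mem_cat => /orP[]; first exact: known.
exact: map_block_known.
Qed.

Theorem sat_of_clique (W : seq (nat * label)) : uniq W -> {subset W <= P} -> 3 * N <= size W + 2 ->
  {in W &, forall u v, u != v -> adj u v} -> has_sat_of_weight C k.
Proof.
move=> uW sW zW aW.
(* Within the family, [h] is common and block ends are determined by their indices, so a vertex is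
   determined by its copy number and its index list. This leaves [3 * N] colors. *)
pose color (u : nat * label) := (u.1, map fst u.2.2).
have wP u : u \in W -> [/\ u.1 < 3, u.2.1 \in lists q (items n k), u.2.2 \in lists q (items n k) & valid n k gs out u.2].
  by move=> /sW; rewrite mem_vertices => /and4P.
have itm u x : u \in W -> x \in u.2.1 ++ u.2.2 -> x.1 <= k.
  move=> /wP[_ + + _]; rewrite !mem_lists => /andP[_ /allP h1] /andP[_ /allP h2].
  by rewrite mem_cat => /orP[/h1|/h2]; rewrite mem_items => /and3P[].
have sameh u v : u \in W -> v \in W -> u.2.1 = v.2.1.
  move=> uw vw; case: (u =P v) => [-> //|/eqP ne].
  by have /andP[_ /andP[/eqP]] := aW u v uw vw ne.
(* All claims of the family form one function: distinct members agree by adjacency, while claims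
   within a member and the anchors are settled by validity. *)
have glob u v x y : u \in W -> v \in W ->
    x \in (0, 0) :: (k.+1, n.+1) :: points (u.2.1 ++ u.2.2) -> y \in points (v.2.1 ++ v.2.2) ->
    x.1 = y.1 -> x.2 = y.2.
  move=> uw vw xu yv.
  have [xc|xp] : x \in [:: (0, 0); (k.+1, n.+1)] \/ x \in points (u.2.1 ++ u.2.2).
  - by move: xu; rewrite !inE orbA => /orP[]; [left|right].
  - have [_ _ _ /and3P[/functionalP fv _ _]] := wP v vw; apply: fv.
      by move: xc; rewrite !inE orbA => ->.
    by rewrite !inE yv !orbT.
  case: (u =P v) => [e|/eqP ne].
    have [_ _ _ /and3P[/functionalP fv _ _]] := wP v vw; apply: fv; rewrite !inE ?yv ?orbT //.
    by rewrite -e xp !orbT.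
  have /andP[_ /andP[/eqP eh /functionalP fuv]] := aW u v uw vw ne; apply: fuv.
    by apply: points_sub xp => z; rewrite !mem_cat => /orP[] ->; rewrite ?orbT.
  by apply: points_sub yv => z; rewrite -eh !mem_cat => /orP[] ->; rewrite ?orbT.
have color_inj : {in W &, injective color}.
  move=> u v uw vw [e1 e2].
  have ev : u.2.2 = v.2.2.
    have sz : size u.2.2 = size v.2.2 by rewrite -(size_map fst) e2 size_map.
    apply: (@eq_from_nth _ (0, (0, 0))) => // i ilt.
    set x := nth _ u.2.2 i; set y := nth _ v.2.2 i.
    have xu : x \in u.2.1 ++ u.2.2 by rewrite mem_cat mem_nth ?orbT.
    have yv : y \in v.2.1 ++ v.2.2 by rewrite mem_cat mem_nth ?orbT // -sz.
    have exy : x.1 = y.1.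
      by rewrite -[LHS](nth_map _ 0 fst) // e2 (nth_map (0, (0, 0))) // -sz.
    have [px1 px2] := mem_points xu; have [py1 py2] := mem_points yv.
    have l1 : x.2.1 = y.2.1.
      by apply: (glob u v (x.1, x.2.1) (y.1, y.2.1)) => //; rewrite !inE px1 !orbT.
    have l2 : x.2.2 = y.2.2.
      apply: (glob u v (x.1.+1, x.2.2) (y.1.+1, y.2.2)) => //=; last by rewrite exy.
      by rewrite !inE px2 !orbT.
    by move: exy l1 l2; case: (x) (y) => [i1 [l1 r1]] [i2 [l2 r2]] /= -> -> ->.
  move: e1 ev (sameh u v uw vw); case: (u) (v) => [b [h s]] [b' [h' s']] /= -> -> -> //.
(* An unrealized list would exclude its three colors and leave at most [3 * N - 3] vertices, while
   [W] has at least [3 * N - 2]. *)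
have ex J : J \in lists q (iota 0 k.+1) -> exists2 u, u \in W & map fst u.2.2 = J.
  move=> mJ; case e: (has (fun u => map fst u.2.2 == J) W).
    by case/hasP: e => u uw /eqP eu; exists u.
  have sub : {subset map color W <= [seq (b, J) | b <- iota 0 3, J <- rem J (lists q (iota 0 k.+1))]}.
    move=> _ /mapP[u uw ->]; apply/allpairsP; exists (color u); split=> //.
      by case: (wP u uw) => h _ _ _; rewrite (mem_iota 0 3 u.1).
    rewrite (rem_filter _ (uniq_lists q (iota_uniq 0 k.+1))) mem_filter /=.
    move/negbT/hasPn/(_ u uw): e => -> /=; rewrite mem_lists size_map.
    case: (wP u uw) => _ _ + _; rewrite mem_lists => /andP[-> al] /=.
    apply/allP => _ /mapP[x xu ->]; rewrite -[_ :: _]/(iota 0 k.+1) mem_iota add0n ltnS leq0n /=.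
    by apply: (itm u x uw); rewrite mem_cat xu orbT.
  have := uniq_leq_size _ sub; rewrite (map_inj_in_uniq color_inj) => /(_ uW).
  rewrite size_map size_allpairs size_rem // size_lists !size_iota -/N.
  have : 0 < N by rewrite expn_gt0.
  move=> n0 le; have := leq_trans zW (leq_add le (leqnn 2)).
  by case: (N) n0 => // N1 _; rewrite mulnS /= => h; exfalso; lia.
have q0 : 0 < q by apply: leq_trans C_depth; rewrite expn_gt0.
have nseq_in i : i <= k -> nseq q i \in lists q (iota 0 k.+1).
  move=> ik; rewrite mem_lists size_nseq eqxx andTb.
  by apply/allP => x /nseqP[-> _]; rewrite (mem_iota 0 k.+1 i).
(* The member realizing the constant list of index [i] provides the block that defines cut [i]. *)
pose wit i := nth (0, ([::], [::])) W (find (fun u => map fst u.2.2 == nseq q i) W).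
have witP i : i <= k -> wit i \in W /\ map fst (wit i).2.2 = nseq q i.
  move=> ik; have [u uw eu] := ex _ (nseq_in i ik).
  have h : has (fun u => map fst u.2.2 == nseq q i) W by apply/hasP; exists u => //; apply/eqP.
  by split; [rewrite mem_nth // -has_find|apply/eqP; exact: (nth_find _ h)].
pose it i := head (0, (0, 0)) (wit i).2.2.
have itP i : i <= k -> it i \in (wit i).2.2 /\ (it i).1 = i.
  move=> ik; have [_] := witP i ik; rewrite /it; case: (wit i).2.2 => [|x s] /=.
    by case: (q) q0.
  by rewrite mem_head; case: (q) q0 => //= q' _ [-> _].
(* Cut [k + 1] starts no block; its position comes from the anchor. *)
pose pos i := if i <= k then (it i).2.1 else n.+1.
have posP u x : u \in W -> x \in u.2.1 ++ u.2.2 -> x.2.1 = pos x.1 /\ x.2.2 = pos x.1.+1.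
  move=> uw xu; have xk := itm u x uw xu; have [p1 p2] := mem_points xu.
  have pit i : i <= k -> (i, (it i).2.1) \in (0, 0) :: (k.+1, n.+1) :: points ((wit i).2.1 ++ (wit i).2.2).
    move=> ik; have [m e] := itP i ik.
    have mi : it i \in (wit i).2.1 ++ (wit i).2.2 by rewrite mem_cat m orbT.
    by have [h _] := mem_points mi; rewrite e in h; rewrite !inE h !orbT.
  rewrite /pos xk; split.
    have [ww _] := witP _ xk.
    by have /= <- := glob _ u _ _ ww uw (pit _ xk) p1.
  case: ltnP => [lt|le].
    have [ww _] := witP _ lt.
    by have /= <- := glob _ u _ _ ww uw (pit _ lt) p2.
  have ek : x.1 = k by apply/eqP; rewrite eqn_leq xk.
  apply/esym; apply: (glob u u (k.+1, n.+1) (x.1.+1, x.2.2)) => //=; last by rewrite ek.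
  by rewrite !inE eqxx orbT.
pose c := mkseq pos k.+2.
have nthc i : i < k.+2 -> nth 0 c i = pos i by move=> ik; rewrite nth_mkseq.
have cc : cuts n k c.
  split; last 2 first.
  - rewrite nthc // /pos /=; have [m e] := itP 0 (leq0n k); have [ww _] := witP 0 (leq0n k).
    have xu : it 0 \in (wit 0).2.1 ++ (wit 0).2.2 by rewrite mem_cat m orbT.
    have [p1 _] := mem_points xu.
    apply/esym; apply: (glob _ _ (0, 0) ((it 0).1, (it 0).2.1) ww ww) => //.
  - by rewrite nthc // /pos ltnn.
  - apply/(sortedP 0) => i; rewrite size_mkseq ltnS => ik.
    rewrite !nthc //; last exact: ltnW.
    rewrite ltnS in ik; have [m e] := itP i ik; have [ww _] := witP i ik.
    have xu : it i \in (wit i).2.1 ++ (wit i).2.2 by rewrite mem_cat m orbT.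
    have [e1 e2] := posP _ _ ww xu; rewrite e in e1 e2; rewrite -e1 -e2.
    by have [_ _ _ /and3P[_ /allP/(_ _ xu)]] := wP _ ww.
  - by rewrite size_mkseq.
have blk u x : u \in W -> x \in u.2.1 ++ u.2.2 -> x.1 <= k /\ x = block c x.1.
  move=> uw xu; have xk := itm u x uw xu; split=> //.
  have [e1 e2] := posP u x uw xu.
  by rewrite /block !nthc ?ltnS ?(leqW xk) // -e1 -e2; case: (x) => ? [].
have sa : size (input_of_cuts n c) == n by rewrite size_mkseq.
exists (Tuple sa); split; first exact: count_input_of_cuts cc.
have [F [sF aF kF]] := kleene_eval_certificate C_wf (eqP sa) C_weft.
have [J [sJ aJ cJ]] := cover_positions cc (leq_trans sF C_depth) aF.
(* The acceptance of this member is conclusive: its own blocks cover the certificate of the input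
   just reconstructed. *)
have [u uw eu] : exists2 u, u \in W & map fst u.2.2 = J.
  by apply: ex; rewrite mem_lists sJ eqxx andTb; apply: sub_all aJ => i; rewrite mem_iota.
have [_ _ _ /and3P[_ _ /eqP]] := wP u uw; rewrite kF => [[]//||].
  exact: view_consistent cc (blk u ^~ uw).
move=> m mF; have [i iJ im] := cJ m mF.
move: iJ; rewrite -eu => /mapP[x xu ex'].
have xuu : x \in u.2.1 ++ u.2.2 by rewrite mem_cat xu orbT.
apply: (view_knows_item (k := k) (x := x)) => //.
- by move=> y; apply: blk.
- exact: (allP aF).
- by have [_ ->] := blk u x uw xuu; rewrite -ex'.
Qed.

End Clique.

(** * The temporal graph of a graph *)

(** All pairs are taken; a pair that is not an arc merely gives an isolated subdivision vertex.
    Positions in this list are the common order of both halves of the arcs. *)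
Definition node_pairs (T : Type) (P : seq T) : seq (T * T) := [seq (p, q) | p <- P, q <- P].

(** [(false, (p, p))] stands for the vertex [p] and [(true, (p, q))] for the vertex
    subdividing the arc from [p] to [q]. *)
Definition nodes (T : Type) (P : seq T) : seq (bool * (T * T)) :=
  [seq (false, (p, p)) | p <- P] ++ [seq (true, e) | e <- node_pairs P].

Definition times (T : Type) (P : seq T) : seq (bool * (T * T)) :=
  [seq (false, e) | e <- node_pairs P] ++ [seq (true, e) | e <- node_pairs P].

(** The arc [(p, q)] is entered from [p] at time [(false, (p, q))] and left towards
    [q] at time [(true, (p, q))]. *)
Definition active (T : eqType) (adj : rel T) (x y t : bool * (T * T)) : bool :=
  let end_point := (false, if t.1 then (t.2.2, t.2.2) else (t.2.1, t.2.1)) in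
  adj t.2.1 t.2.2 &&
  (((x == (true, t.2)) && (y == end_point)) || ((x == end_point) && (y == (true, t.2)))).

(** Makes maximality harmless: a large connected set suffices. Enlarging the set shrinks its
    complement, so the process stops; connectedness is a mere proposition, hence the classical case
    distinction. *)
Lemma extend_to_TCC (V : finType) (tau : nat) (G : tgraph V tau) (X : {set V}) :
  temporal_connected_set G X -> exists2 Y : {set V}, is_TCC G Y & X \subset Y.
Proof.
have [m] := ubnP #|~: X|; elim: m X => // m IH X le cX.
case: (classic (exists2 Y : {set V}, temporal_connected_set G Y & X \proper Y)) => [[Y cY XY]|no].
  have [|Z tZ YZ] := IH Y _ cY.
    rewrite ltnS in le; apply: leq_trans le; apply: proper_card.
    by rewrite properC.
  by exists Z => //; apply: subset_trans (proper_sub XY) YZ.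
exists X => //; split=> // Y cY XY; apply/eqP; rewrite eqEsubset XY andbT.
by apply: contra_notT no => YX; exists Y; rewrite // properE XY.
Qed.

Section Construction.
Variables (T : eqType) (P : seq T) (adj : rel T).
Hypotheses (P_uniq : uniq P) (adj_irr : irreflexive adj).

Let E := node_pairs P.
Let M := size E.
Let nd (v : 'I_(size (nodes P))) := tnth (in_tuple (nodes P)) v.
Let tm (t : 'I_(size (times P))) := tnth (in_tuple (times P)) t.

Lemma active_sym x y t : active adj x y t = active adj y x t.
Proof. by rewrite /active; congr (_ && _); rewrite orbC; congr (_ || _); rewrite andbC. Qed.

Lemma active_irr x t : active adj x x t = false.
Proof.
apply/negbTE/negP => /andP[_ /orP[]] /andP[/eqP -> /eqP] //.
Qed.

Definition arc_edge : rel 'I_(size (nodes P)) := fun u v => [exists t, active adj (nd u) (nd v) (tm t)].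
Definition arc_lab (u v : 'I_(size (nodes P))) : {set 'I_(size (times P))} :=
  [set t | active adj (nd u) (nd v) (tm t)].

Lemma arc_edge_sym : symmetric arc_edge.
Proof. by move=> u v; apply: eq_existsb => t; rewrite active_sym. Qed.

Lemma arc_edge_irr : irreflexive arc_edge.
Proof. by move=> u; apply/existsP => -[t]; rewrite active_irr. Qed.

Lemma arc_lab_sym u v : arc_lab u v = arc_lab v u.
Proof. by apply/setP => t; rewrite !inE active_sym. Qed.

Lemma arc_lab_nonedge u v : ~~ arc_edge u v -> arc_lab u v = set0.
Proof.
by move=> /existsPn h; apply/setP => t; rewrite !inE; apply/negbTE.
Qed.

Definition arc_tgraph : tgraph 'I_(size (nodes P)) (size (times P)) :=
  TGraph arc_edge_sym arc_edge_irr arc_lab_sym arc_lab_nonedge.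

(** Replaces ordinals by plain lists, the form in which the program computes the encoding. *)
Lemma enc_arc_tgraph : enc_tgraph (TGraphInst arc_tgraph) =
  enc_nat (size (nodes P)) ++ enc_nat (size (times P)) ++
  flatten [seq has (active adj x y) (times P) :: [seq active adj x y t | t <- times P]
          | x <- nodes P, y <- nodes P].
Proof.
rewrite /enc_tgraph /=; congr (_ ++ (_ ++ flatten _)).
have en : nodes P = [seq nd v | v <- enum 'I_(size (nodes P))].
  exact: (esym (map_tnth_enum (in_tuple (nodes P)))).
have et : times P = [seq tm t | t <- enum 'I_(size (times P))].
  exact: (esym (map_tnth_enum (in_tuple (times P)))).
pose f x y := has (active adj x y) (times P) :: [seq active adj x y t | t <- times P].
rewrite -[RHS]/[seq f x y | x <- nodes P, y <- nodes P].
have -> : [seq f x y | x <- nodes P, y <- nodes P] =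
    [seq f x y | x <- [seq nd v | v <- enum 'I_(size (nodes P))],
                 y <- [seq nd v | v <- enum 'I_(size (nodes P))]] by rewrite -en.
rewrite allpairs_mapl allpairs_mapr; apply: eq_allpairs => u v.
rewrite /f; congr (_ :: _).
  have -> : has (active adj (nd u) (nd v)) (times P) =
      has (active adj (nd u) (nd v)) [seq tm t | t <- enum 'I_(size (times P))] by rewrite -et.
  rewrite has_map; apply/existsP/hasP => [[t h]|[t _ h]]; exists t => //.
  by rewrite mem_enum.
have -> : [seq active adj (nd u) (nd v) t | t <- times P] =
    [seq active adj (nd u) (nd v) t | t <- [seq tm t | t <- enum 'I_(size (times P))]] by rewrite -et.
by rewrite -map_comp; apply: eq_map => t; rewrite /= inE.
Qed.

(** * Reachability in the temporal graph *)

Let idx e := index e E.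
Let G := arc_tgraph.

Lemma uniq_node_pairs : uniq E.
Proof. by apply: allpairs_uniq => // -[? ?] [? ?] _ _ [-> ->]. Qed.

Lemma mem_node_pairs p q : ((p, q) \in E) = (p \in P) && (q \in P).
Proof.
by apply/allpairsP/andP => [[[p' q'] [/= hp hq [-> ->]]]|[hp hq]]; last by exists (p, q).
Qed.

Lemma uniq_tagged_pairs (b : bool) : uniq [seq (b, e) | e <- E].
Proof. by rewrite map_inj_uniq ?uniq_node_pairs // => ? ? []. Qed.

Lemma uniq_nodes : uniq (nodes P).
Proof.
rewrite cat_uniq uniq_tagged_pairs andbT map_inj_uniq ?P_uniq => [|p q [] //].
by apply/hasPn => x /mapP[e _ ->]; apply/negP => /mapP[].
Qed.

Lemma uniq_times : uniq (times P).
Proof.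
rewrite cat_uniq !uniq_tagged_pairs andbT.
by apply/hasPn => x /mapP[e _ ->]; apply/negP => /mapP[].
Qed.

Lemma nd_inj : injective nd.
Proof. by apply/tuple_uniqP; exact: uniq_nodes. Qed.

Lemma nd_cases v : (exists2 p, p \in P & nd v = (false, (p, p))) \/
  (exists p q, [/\ p \in P, q \in P & nd v = (true, (p, q))]).
Proof.
have : nd v \in nodes P by exact: mem_tnth.
rewrite mem_cat => /orP[/mapP[p pP ->]|/mapP[[p q] + ->]]; first by left; exists p.
by rewrite mem_node_pairs => /andP[pP qP]; right; exists p, q.
Qed.

Lemma time_val t : val t = (if (tm t).1 then M else 0) + idx (tm t).2 /\ idx (tm t).2 < M.
Proof.
have tin : tm t \in times P by exact: mem_tnth.
have tv : val t = index (tm t) (times P).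
  by rewrite /tm (tnth_nth (tm t)) /= index_uniq ?uniq_times.
move: tin; rewrite tv mem_cat /idx /M.
have inj (b : bool) : injective (fun e : T * T => (b, e)) by move=> ? ? [].
case/orP => /mapP[e eE ->] /=; (split; last by rewrite index_mem).
  by rewrite /times index_cat (mem_map (inj false)) eE (index_map (inj false)).
rewrite /times index_cat ifN; last by apply/negP => /mapP[].
by rewrite size_map (index_map (inj true)).
Qed.

(** Limits on reachability are proved by invariants relating the current vertex to the last time
    used. *)
Lemma walk_invariant (I : 'I_(size (nodes P)) -> nat -> Prop) :
  (forall u w t s, I u s -> s <= val t -> active adj (nd u) (nd w) (tm t) -> I w (val t)) ->
  forall p u v, temporal_path G u v p -> I u 0 -> exists s, I v s.
Proof.
move=> step p u v /and4P[walk _ srt /eqP <-].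
have {srt} : path leq 0 [seq val t | t <- unzip2 p].
  by move: srt; case: (unzip2 p).
elim: p u 0 walk => [|[w t] p IH] u s /=; first by exists s.
case/and3P => _; rewrite inE => act walk /andP[le srt] Iu.
exact: IH walk srt (step _ _ _ _ Iu le act).
Qed.

Lemma active_cases x w t : active adj (nd x) (nd w) (tm t) ->
  exists p q, adj p q /\
    ([/\ val t = idx (p, q), val t < M &
        (nd x = (true, (p, q)) /\ nd w = (false, (p, p))) \/
        (nd x = (false, (p, p)) /\ nd w = (true, (p, q)))] \/
     (val t = M + idx (p, q) /\
        ((nd x = (true, (p, q)) /\ nd w = (false, (q, q))) \/
         (nd x = (false, (q, q)) /\ nd w = (true, (p, q)))))).
Proof.
have [vt it] := time_val t; case: (tm t) vt it => [ph [p q]] vt it /andP[/= apq act].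
exists p, q; split=> //; case: ph vt it act => vt it act; [right|left]; split=> //.
- by case/orP: act => /andP[/eqP -> /eqP ->]; [left|right].
- by rewrite vt.
- by case/orP: act => /andP[/eqP -> /eqP ->]; [left|right].
Qed.

Lemma reaches_vertex u v a b : nd u = (false, (a, a)) -> nd v = (false, (b, b)) ->
  reaches G u v -> a = b \/ adj a b.
Proof.
move=> eu ev [p].
(* At early times the walk only moves between [a] and the arcs leaving [a]. The first late move
   fixes a vertex [z], and from then on only [z] and arcs entering [z] are within reach. *)
pose I (w : 'I_(size (nodes P))) (s : nat) :=
  nd w = (false, (a, a)) \/ (exists z, nd w = (true, (a, z))) \/
  (M <= s /\ exists z, (z = a \/ adj a z) /\
     (nd w = (false, (z, z)) \/ exists y, nd w = (true, (y, z)))).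
move=> /(@walk_invariant I) h; have [||s] := h; last first.
- rewrite /I ev => -[[->]|[[? //]|[_ [z [hz [[->]|[? //]]]]]]]; first by left.
  by case: hz => [->|]; [left|right].
- by left.
move=> {h} x w t s Ix st /active_cases[c [d [acd [[vt early]|[vt]]]]].
- have nl : ~ M <= s by move=> Ms; have := leq_trans Ms st; rewrite leqNgt early.
  case: Ix => [ex|[[z ex]|[/nl //]]]; move=> [] [] + ew; rewrite ex => e; try discriminate; case: e => *; subst.
  + by right; left; eexists; exact: ew.
  + by left.
have late : M <= val t by rewrite vt leq_addr.
case: Ix => [ex|[[z ex]|[_ [z [hz [ex|[y ex]]]]]]]; move=> [] [] + ew; rewrite ex => e0; try discriminate; case: e0 => *; subst.
all: right; right; split=> //; eexists.
all: split; last first; [by [left; exact: ew|right; eexists; exact: ew]|].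
all: by [exact: hz|left|right].
Qed.

Lemma reaches_arc u v a b c d : nd u = (true, (a, b)) -> nd v = (true, (c, d)) ->
  reaches G u v -> idx (a, b) <= idx (c, d) \/ d = a.
Proof.
move=> eu ev [p].
(* The first move is at time [idx (a, b)] towards [a] or [M + idx (a, b)] towards [b]. As both
   halves are ordered alike, arcs entered later do not precede [(a, b)]; only arcs into [a] escape,
   since after an early arrival at [a] all their late halves are still to come. *)
pose I (w : 'I_(size (nodes P))) (s : nat) :=
  (exists z, nd w = (true, (a, z)) /\ idx (a, b) <= idx (a, z)) \/
  nd w = (false, (a, a)) /\ idx (a, b) <= s \/
  (M <= s /\ exists z,
     (nd w = (false, (z, z)) /\ (M + idx (a, b) <= s \/ z = a)) \/
     (exists y, nd w = (true, (y, z)) /\ (idx (a, b) <= idx (y, z) \/ z = a))).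
move=> /(@walk_invariant I) h; have [||s] := h; last first.
- rewrite /I ev => -[[z [[-> ->]]]|[[//]|[_ [z [[//]|[y [[-> ->]]]]]]]] //.
  by left.
- by left; exists b.
move=> {h} x w t s Ix st /active_cases[e [f [aef [[vt early]|[vt]]]]].
- have nl : ~ M <= s by move=> Ms; have := leq_trans Ms st; rewrite leqNgt early.
  case: Ix => [[z [ex le]]|[[ex le]|[/nl //]]]; move=> [] [] + ew; rewrite ex => e0; try discriminate; case: e0 => *; subst.
  + by right; left; rewrite vt.
  + by left; exists f; split=> //; rewrite -vt; apply: leq_trans le st.
have late : M <= val t by rewrite vt leq_addr.
case: Ix => [[z [ex le]]|[[ex le]|[Ms [z [[ex le]|[y [ex le]]]]]]]; move=> [] [] + ew; rewrite ex => e0; try discriminate; case: e0 => *; subst.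
- right; right; split=> //; eexists; left; split; first exact: ew.
  by left; rewrite vt leq_add2l.
- right; right; split=> //; eexists; right; eexists; split; first exact: ew.
  by right.
- right; right; split=> //; eexists; right; eexists; split; first exact: ew.
  case: le => [le|]; [left|by right].
  by have := leq_trans le st; rewrite vt leq_add2l.
- right; right; split=> //; eexists; left; split; first exact: ew.
  by case: le => [le|]; [left; rewrite vt leq_add2l|right].
Qed.

Lemma reaches_loop u v a : nd u = (true, (a, a)) -> reaches G u v -> v = u.
Proof.
move=> eu [p].
move=> /(@walk_invariant (fun w _ => w = u)) h; have [||s] := h => //.
move=> x w t s -> _ /active_cases[c [d [acd]]]; rewrite eu.
by case=> [[_ _ [[[e1 e2]]|[]//]]|[_ [[[e1 e2]]|[]//]]]; move: acd; rewrite -e1 -e2 adj_irr.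
Qed.

Lemma index_of_node x : x \in nodes P -> exists v, nd v = x.
Proof.
move=> xP; have lt : index x (nodes P) < size (nodes P) by rewrite index_mem.
by exists (Ordinal lt); rewrite /nd (tnth_nth x) /= nth_index.
Qed.

Lemma index_of_time x : x \in times P -> exists t, tm t = x.
Proof.
move=> xP; have lt : index x (times P) < size (times P) by rewrite index_mem.
by exists (Ordinal lt); rewrite /tm (tnth_nth x) /= nth_index.
Qed.

Lemma adj_reaches u v p q : nd u = (false, (p, p)) -> nd v = (false, (q, q)) ->
  p \in P -> q \in P -> adj p q -> reaches G u v.
Proof.
move=> eu ev pP qP apq.
have eE : (p, q) \in E by rewrite mem_node_pairs pP.
have [x ex] : exists x, nd x = (true, (p, q)).
  by apply: index_of_node; rewrite mem_cat (map_f (pair true)) ?orbT.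
have [t1 et1] : exists t, tm t = (false, (p, q)).
  by apply: index_of_time; rewrite mem_cat (map_f (pair false)).
have [t2 et2] : exists t, tm t = (true, (p, q)).
  by apply: index_of_time; rewrite mem_cat (map_f (pair true)) ?orbT.
have a1 : active adj (nd u) (nd x) (tm t1) by rewrite eu ex et1 /active /= apq !eqxx ?orbT.
have a2 : active adj (nd x) (nd v) (tm t2) by rewrite ev ex et2 /active /= apq !eqxx ?orbT.
have npq : p != q by apply: contraL apq => /eqP ->; rewrite adj_irr.
exists [:: (x, t1); (v, t2)]; apply/and4P; split=> /=.
- rewrite !inE a1 a2 !andbT; apply/andP; split; apply/existsP; [by exists t1|by exists t2].
- rewrite !inE !andbT negb_or -!(inj_eq nd_inj) eu ev ex !andbT /=.
  by apply/eqP => -[/eqP]; rewrite (negbTE npq).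
- have [-> _] := time_val t1; have [-> _] := time_val t2; rewrite et1 et2 /= andbT.
  by rewrite leq_addl.
- exact: eqxx.
Qed.

Lemma TCC_of_clique (W : seq T) : uniq W -> {subset W <= P} ->
  {in W &, forall p q, p != q -> adj p q} ->
  exists2 X, is_TCC G X & size W <= #|X|.
Proof.
move=> uW sW aW; pose X := [set v | ~~ (nd v).1 & (nd v).2.1 \in W].
have cX : temporal_connected_set G X.
  have one u v : u \in X -> v \in X -> reaches G u v.
    rewrite !inE => /andP[u1 u2] /andP[v1 v2].
    case: (u =P v) => [->|/eqP ne]; first by exists [::]; rewrite /temporal_path /= eqxx.
    have [[p pP eu]|[p [q [_ _ eu]]]] := nd_cases u; rewrite eu in u1 u2 => //.
    have [[q qP ev]|[q [q' [_ _ ev]]]] := nd_cases v; rewrite ev in v1 v2 => //.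
    apply: (adj_reaches eu ev) => //; apply: aW => //.
    by apply: contra ne => /eqP epq; rewrite -(inj_eq nd_inj) eu ev epq.
  by move=> u v uX vX; split; apply: one.
have [Y tY XY] := extend_to_TCC cX; exists Y => //.
apply: leq_trans (subset_leq_card XY); rewrite cardE -(size_map nd).
rewrite -(size_map (fun p : T => (false, (p, p)))); apply: uniq_leq_size.
  by rewrite map_inj_uniq // => p q [].
move=> _ /mapP[p pW ->].
have [v ev] : exists v, nd v = (false, (p, p)).
  by apply: index_of_node; rewrite mem_cat (map_f (fun p => (false, (p, p)))) // sW.
by rewrite -ev map_f // mem_enum inE ev.
Qed.

Lemma clique_of_connected (X : {set 'I_(size (nodes P))}) : temporal_connected_set G X -> 1 < #|X| ->
  exists W : seq T, [/\ uniq W, {subset W <= P}, #|X| <= size W + 2 &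
    {in W &, forall p q, p != q -> adj p q}].
Proof.
move=> cX X2; pose B := [set v in X | (nd v).1].
have rX u v : u \in X -> v \in X -> reaches G u v by move=> uX vX; have [] := cX u v uX vX.
(* A loop is never active, so its vertex is isolated and cannot share [X] with a second vertex. *)
have arc u : u \in B -> exists a b, [/\ nd u = (true, (a, b)), a != b & (a, b) \in E].
  rewrite inE => /andP[uX]; have [[p pP ->] //|[a [b [aP bP eu]]] _] := nd_cases u.
  exists a, b; split=> //; last by rewrite mem_node_pairs aP.
  apply/eqP => eab; rewrite -eab in eu.
  move: X2; rewrite ltnNge => /negP; apply; rewrite -(cards1 u).
  by apply: subset_leq_card; apply/subsetP => v vX; rewrite inE (reaches_loop eu (rX u v uX vX)).
pose f v := idx (nd v).2.
have f_inj : {in B &, injective f}.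
  move=> u v /arc[a [b [eu _ iu]]] /arc[c [d [ev _ iv]]]; rewrite /f eu ev /= => /(congr1 (nth (a, b) E)).
  by rewrite !nth_index // => e; apply: nd_inj; rewrite eu ev e.
(* The later arc has to reach the earlier one, which only the exceptional case of [reaches_arc]
   allows. *)
have back u v : u \in B -> v \in B -> f u < f v -> (nd u).2.2 = (nd v).2.1.
  move=> uB vB; have [a [b [eu _ _]]] := arc u uB; have [c [d [ev _ _]]] := arc v vB.
  rewrite /f eu ev /= ltnNge => /negbTE nle.
  have uX : u \in X by move: uB; rewrite inE => /andP[].
  have vX : v \in X by move: vB; rewrite inE => /andP[].
  by case: (reaches_arc ev eu (rX v u vX uX)); rewrite ?nle.
(* Three subdivision vertices would make the middle one subdivide a loop. *)
have chain u v w : u \in B -> v \in B -> w \in B -> f u < f v -> f v < f w -> False.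
  move=> uB vB wB uv vw.
  have [a [b [ev /eqP nab _]]] := arc v vB; apply: nab.
  have := back u v uB vB uv; have := back u w uB wB (ltn_trans uv vw); have := back v w vB wB vw.
  by rewrite ev /= => -> -> ->.
have cB : #|B| <= 2.
  rewrite leqNgt; apply/negP => /card_gt2P[u [v [w [[uB vB wB] [nuv nvw nwu]]]]].
  have df x y : x \in B -> y \in B -> x != y -> f x != f y.
    by move=> xB yB; apply: contra => /eqP /f_inj ->.
  move: (df _ _ uB vB nuv) (df _ _ vB wB nvw) (df _ _ wB uB nwu).
  case: (ltngtP (f u) (f v)) => // uv _; case: (ltngtP (f v) (f w)) => // vw _;
    case: (ltngtP (f w) (f u)) => // wu _.
  - by apply: (chain u v w).
  - by apply: (chain u v w).
  - by apply: (chain w u v).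
  - by apply: (chain u w v).
  - by apply: (chain v w u).
  - by apply: (chain v u w).
  - by apply: (chain w v u).
  - by apply: (chain w v u).
pose W := [seq (nd v).2.1 | v <- enum (X :\: B)].
have out v : v \in X :\: B -> v \in X /\ (exists2 p, p \in P & nd v = (false, (p, p))).
  rewrite !inE; case vX: (v \in X) => //=; rewrite ?andbF ?andbT // => v1; split=> //.
  have [//|[a [b [_ _ ev]]]] := nd_cases v.
  by rewrite ev in v1.
exists W; split.
- rewrite map_inj_in_uniq ?enum_uniq // => u v; rewrite !mem_enum.
  move=> /out[_ [p _ eu]] /out[_ [q _ ev]]; rewrite eu ev /= => epq.
  by apply: nd_inj; rewrite eu ev epq.
- by move=> _ /mapP[v + ->]; rewrite mem_enum => /out[_ [p pP ->]].
- rewrite size_map -cardE; have := cardsID B X.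
  have -> : X :&: B = B by apply/setIidPr/subsetP => v; rewrite inE => /andP[].
  by move=> <-; rewrite addnC leq_add2l.
- move=> p q /mapP[u + ->] /mapP[v + ->]; rewrite !mem_enum.
  move=> /out[uX [a aP eu]] /out[vX [b bP ev]]; rewrite eu ev /= => nab.
  case: (reaches_vertex eu ev (rX u v uX vX)) => // e.
  by rewrite e eqxx in nab.
Qed.
End Construction.

(** * The reduction *)

(** Only the length of [w] counts: the word to be parsed is its own fuel, since every productive
    parsing step consumes a letter. *)
Definition iter_step (S : Type) (step : S -> S) (s : S) (w : word) : S :=
  foldl (fun s _ => step s) s w.

Lemma iter_stepE S (step : S -> S) s w : iter_step step s w = iter (size w) step s.
Proof. by elim: w s => //= _ w IH s; rewrite /iter_step /= -/(iter_step _ _ _) IH -iterSr. Qed.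

Definition read_nat_step (st : nat * word) : nat * word :=
  if st.2 is b :: r then if b then (st.1.+1, r) else st else st.

Definition read_nat (w : word) : nat * word :=
  let st := iter_step read_nat_step (0, w) w in (st.1, behead st.2).

Definition read_seq_step (X : Type) (rd : word -> X * word) (st : seq X * word) : seq X * word :=
  if st.2 is b :: r then if b then (rcons st.1 (rd r).1, (rd r).2) else st else st.

Definition read_seq (X : Type) (rd : word -> X * word) (w : word) : seq X * word :=
  let st := iter_step (read_seq_step rd) ([::], w) w in (st.1, behead st.2).

Definition read_gate (w : word) : gcode * word :=
  if w is b1 :: w1 then
    if w1 is b2 :: r then
      if b1 then ((true, (b2, (read_seq read_nat r).1)), (read_seq read_nat r).2)
      else ((false, (false, [:: (read_nat r).1])), (read_nat r).2)
    else ((false, (false, [::])), [::])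
  else ((false, (false, [::])), [::]).

Definition read_circuit (w : word) : nat * (seq gcode * nat) :=
  let a := read_nat w in let b := read_seq read_gate a.2 in (a.1, (b.1, (read_nat b.2).1)).

Arguments read_nat : simpl never.
Arguments read_seq : simpl never.
Arguments read_gate : simpl never.

Lemma read_natE n r : read_nat (enc_nat n ++ r) = (n, r).
Proof.
have main m j : iter j read_nat_step (m, enc_nat n ++ r) =
    (m + minn j n, enc_nat (n - j) ++ r).
  elim: j => [|j IH]; first by rewrite min0n subn0 addn0.
  have -> : minn j.+1 n = if j < n then (minn j n).+1 else minn j n by case: ltnP => h; lia.
  rewrite iterS IH; move: (minn j n) => m'; case: ltnP => h.
    by rewrite /read_nat_step -(subnSK h) /= addnS.
  have [-> ->] : n - j = 0 /\ n - j.+1 = 0 by lia.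
  by [].
have -> : read_nat (enc_nat n ++ r) = (n, behead (enc_nat 0 ++ r)).
  rewrite /read_nat iter_stepE main /=.
  have -> : minn (size (enc_nat n ++ r)) n = n.
    by apply/minn_idPr; rewrite size_cat size_rcons size_nseq; lia.
  by have -> : n - size (enc_nat n ++ r) = 0 by rewrite size_cat size_rcons size_nseq; lia.
by [].
Qed.

Lemma read_seqE (Y X : Type) (e : Y -> word) (g : Y -> X) (rd : word -> X * word) :
  (forall y r, rd (e y ++ r) = (g y, r)) ->
  forall s r, read_seq rd (enc_seq e s ++ r) = (map g s, r).
Proof.
move=> rdE s r.
have main s1 s2 s' : iter (size s1) (read_seq_step rd)
     (map g s2, enc_seq e (s1 ++ s') ++ r) = (map g (s2 ++ s1), enc_seq e s' ++ r).
  elim: s1 s2 => [|y s1 IH] s2; first by rewrite cats0.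
  rewrite iterSr /read_seq_step /= -/(read_seq_step rd).
  rewrite /enc_seq /= rcons_cat -/(enc_seq e _) -catA /= rdE /=.
  by rewrite -map_rcons IH cat_rcons.
(* Fuel is left over when the end mark is met; the state then stays put. *)
have stable j t : iter j (read_seq_step rd) (t, enc_seq e [::] ++ r) = (t, enc_seq e [::] ++ r).
  by elim: j => // j IH; rewrite iterS IH.
have le : size s <= size (enc_seq e s ++ r).
  rewrite size_cat size_rcons; have : size s <= size (flatten [seq true :: e x | x <- s]).
    by elim: (s) => //= y s' IH; rewrite size_cat ltnS; apply: leq_trans IH (leq_addl _ _).
  by lia.
rewrite /read_seq iter_stepE -(subnK le) iterD.
by have := main s [::] [::]; rewrite cats0 /= => ->; rewrite stable.
Qed.

Lemma read_gateE g r : read_gate (enc_gate g ++ r) = (code_gate g, r).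
Proof.
have rs s : read_seq read_nat (enc_seq enc_nat s ++ r) = (s, r).
  by rewrite (read_seqE (g := id) read_natE) map_id.
by case: g => [i|s|s]; rewrite /enc_gate -?catA /= /read_gate ?read_natE ?rs.
Qed.

Lemma read_circuitE C : read_circuit (enc_circuit C) =
  (ninputs C, (map code_gate (gates C), outnode C)).
Proof.
have E w n r gs r' o r'' : read_nat w = (n, r) -> read_seq read_gate r = (gs, r') ->
    read_nat r' = (o, r'') -> read_circuit w = (n, (gs, o)).
  by move=> h1 h2 h3; rewrite /read_circuit h1 [(n, r).2]/= h2 [(gs, r').2]/= h3.
apply: E; [exact: read_natE|exact: (read_seqE read_gateE)|].
by rewrite -[enc_nat _]cats0; exact: read_natE.
Qed.

Ltac ptime_step := first
  [ assumption
  | exact: ptime_id | exact: ptime_fst | exact: ptime_snd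
  | exact: ptime_const
  | match goal with
    | |- ptime (fun _ => fst _) => apply: ptime_fst_of
    | |- ptime (fun _ => snd _) => apply: ptime_snd_of
    | |- ptime (fun _ => (_, _)) => apply: ptime_pair
    | |- ptime (fun _ => cons _ _) => apply: ptime_cons
    | |- ptime (fun _ => S _) => apply: ptime_S
    | |- ptime (fun _ => Some _) => apply: ptime_Some
    | |- ptime (fun _ => andb _ _) => apply: ptime_and
    | |- ptime (fun _ => orb _ _) => apply: ptime_or
    | |- ptime (fun _ => implb _ _) => apply: ptime_imply
    | |- ptime (fun _ => negb _) => apply: ptime_neg
    | |- ptime (fun _ => leq _ _) => apply: ptime_leq
    | |- ptime (fun _ => nth _ _ _) => apply: ptime_nth
    | |- ptime (fun _ => size _) => apply: ptime_size
    | |- ptime (fun _ => rcons _ _) => apply: ptime_rcons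
    | |- ptime (fun _ => cat _ _) => apply: ptime_cat
    | |- ptime (fun _ => behead _) => apply: ptime_behead
    | |- ptime (fun _ => head _ _) => apply: ptime_head
    | |- ptime (fun _ => iota 0 _) => apply: ptime_iota
    | |- ptime (fun _ => has _ _) => apply: ptime_has
    | |- ptime (fun _ => all _ _) => apply: ptime_all
    | |- ptime (fun _ => if _ then _ else _) => apply: ptime_if
    end ].
Ltac ptime_tac := repeat ptime_step.

(** * Running time of the reduction *)

Lemma ptime_iter_step A S {cA : Code A} {cS : Code S} (step : S -> S) (I : A -> S -> Prop)
    (init : A -> S) (w : A -> word) (beta : A -> nat) :
  ptime step -> ptime init -> ptime w -> polyb (@sz A cA) beta ->
  (forall a, I a (init a)) ->
  (forall a s, I a s -> I a (step s) /\ sz (step s) <= sz s + beta a) ->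
  ptime (fun a => iter_step step (init a) (w a)).
Proof.
move=> ps pi pw pb I0 h.
apply: (@ptime_foldl_inv _ _ _ _ _ _ _ _ (fun _ _ s => step s) beta I) => //.
  apply: (ptime_comp ps); ptime_tac.
by move=> a _ s _; apply: h.
Qed.

Lemma ptime_read_nat_step : ptime read_nat_step.
Proof.
rewrite /read_nat_step.
apply: (@ptime_lcase _ _ _ _ _ _ (fun st : nat * word => st.2) (fun st => st)
  (fun (st : nat * word) b r => if b then (st.1.+1, r) else st)); ptime_tac.
Qed.

Lemma sz_read_nat_step st : sz (read_nat_step st) <= sz st.
Proof.
case: st => n [|[] w] //; rewrite /read_nat_step /= !sz_pair !sz_nat sz_cons; have -> : sz true = 3 by []. by lia.
Qed.

Lemma ptime_read_nat : ptime read_nat.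
Proof.
have p : ptime (fun w => iter_step read_nat_step (0, w) w).
  apply: (@ptime_iter_step _ _ _ _ _ (fun _ _ => True) (fun w => (0, w)) (fun w => w) (fun _ => 0));
    [exact: ptime_read_nat_step|by ptime_tac|by ptime_tac|exact: polyb_const|by []|].
  by move=> a s _; rewrite addn0 sz_read_nat_step.
rewrite /read_nat; ptime_tac.
Qed.

Lemma sz_behead X {cX : Code X} (s : seq X) : sz (behead s) <= sz s.
Proof. by case: s => //= x s; rewrite sz_cons; lia. Qed.

Lemma sz_read_nat w : sz (read_nat w).2 <= sz w.
Proof.
rewrite /read_nat /= iter_stepE; apply: leq_trans (sz_behead _) _.
have : sz (0, w).2 <= sz w by [].
elim: (size w) (0, w) => // j IH st h; rewrite iterSr; apply: IH.
apply: leq_trans h; case: st => n [|[] v] //; rewrite /read_nat_step /= sz_cons; lia.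
Qed.

(** The unread part never grows, so each element is read from a word no larger than the original one
    and the list grows by a polynomial amount per round. *)
Lemma ptime_read_seq X {cX : Code X} (rd : word -> X * word) :
  ptime rd -> (forall w, sz (rd w).2 <= sz w) ->
  ptime (read_seq rd) /\ forall w, sz (read_seq rd w).2 <= sz w.
Proof.
move=> prd rds.
have step_sz st : sz (read_seq_step rd st).2 <= sz st.2.
  case: st => t [|[] v] //; rewrite /read_seq_step /= sz_cons.
  by apply: leq_trans (rds v) _; lia.
have pstep : ptime (read_seq_step rd).
  apply: (@ptime_lcase _ _ _ _ _ _ (fun st : seq X * word => st.2) (fun st => st)
    (fun (st : seq X * word) b r => if b then (rcons st.1 (rd r).1, (rd r).2) else st)); ptime_tac;
    apply: (ptime_comp prd); ptime_tac.
split; last first.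
  move=> w; rewrite /read_seq /= iter_stepE; apply: leq_trans (sz_behead _) _.
  have : sz ([::] : seq X, w).2 <= sz w by [].
  elim: (size w) ([::] : seq X, w) => // j IH st h; rewrite iterSr; apply: IH.
  exact: leq_trans (step_sz st) h.
have [c hc] := ptime_sz prd.
have p : ptime (fun w => iter_step (read_seq_step rd) ([::], w) w).
  apply: (@ptime_iter_step _ _ _ _ _ (fun w st => sz st.2 <= sz w) (fun w => ([::], w)) (fun w => w)
     (fun w => (sz w).+2 ^ c)); [exact: pstep|by ptime_tac|by ptime_tac|by polyb_tac|by []|].
    move=> w [t v] /= h; split; first exact: leq_trans (step_sz (t, v)) h.
    case: v h => [|[] v] h; try by rewrite /read_seq_step /= leq_addr.
    rewrite /read_seq_step /= !sz_pair sz_cons.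
    have e1 := @sz_cat _ cX t [:: (rd v).1]; rewrite cats1 sz_cons in e1.
    have e2 := hc v; have e3 : sz (rd v) = (sz (rd v).1 + sz (rd v).2).+1 by case: (rd v) => *; rewrite sz_pair.
    have le : (sz v).+2 ^ c <= (sz w).+2 ^ c.
      case: (c) => // c'; rewrite leq_exp2r // !ltnS; apply: leq_trans h.
      by rewrite sz_cons; lia.
    have z : @sz (seq X) _ [::] = 1 by [].
    by move: e1 e2 e3 le; rewrite z; lia.
rewrite /read_seq; ptime_tac.
Qed.

Lemma ptime_read_gate : ptime read_gate /\ forall w, sz (read_gate w).2 <= sz w.
Proof.
have [p1 s1] := ptime_read_seq ptime_read_nat sz_read_nat.
split; last first.
  case=> [|b1 [|b2 r]] //; rewrite !sz_cons /read_gate; case: b1.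
    by apply: leq_trans (s1 r) _; lia.
  by apply: leq_trans (sz_read_nat r) _; lia.
apply: (@ptime_lcase _ _ _ _ _ _ (fun w : word => w) (fun _ => ((false, (false, [::])), [::]))
  (fun _ b1 w1 => if w1 is b2 :: r then
      if b1 then ((true, (b2, (read_seq read_nat r).1)), (read_seq read_nat r).2)
      else ((false, (false, [:: (read_nat r).1])), (read_nat r).2)
    else ((false, (false, [::])), [::]))); try by ptime_tac.
apply: (@ptime_lcase _ _ _ _ _ _ (fun p : bool * word * word => p.1.2) (fun _ => ((false, (false, [::])), [::]))
  (fun (p : bool * word * word) b2 r =>
      if p.1.1 then ((true, (b2, (read_seq read_nat r).1)), (read_seq read_nat r).2)
      else ((false, (false, [:: (read_nat r).1])), (read_nat r).2))); try by ptime_tac.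
ptime_tac; first [apply: (ptime_comp p1) | apply: (ptime_comp ptime_read_nat)]; ptime_tac.
Qed.

Lemma ptime_read_circuit : ptime read_circuit.
Proof.
have [pg sg] := ptime_read_gate.
have [ps _] := ptime_read_seq pg sg.
have pn := ptime_read_nat.
have p2 : ptime (fun w => read_seq read_gate (read_nat w).2).
  by apply: (ptime_comp ps); ptime_tac.
rewrite /read_circuit; cbv zeta; ptime_tac.
by apply: (ptime_comp pn); ptime_tac.
Qed.

Lemma ptime_kleene_gate A {cA : Code A} (v : A -> seq (option bool)) (g : A -> gcode) :
  ptime v -> ptime g -> ptime (fun a => kleene_gate (v a) (g a)).
Proof.
move=> pv pg; rewrite /kleene_gate.
have ob : ptime (fun p : A * nat => nth None (v p.1) p.2).
  by ptime_tac; apply: (ptime_comp pv); ptime_tac.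
have pb : ptime (fun p : A * nat => (g p.1).2.1).
  by ptime_tac; apply: (ptime_comp pg); ptime_tac.
have inj := code_option_inj code_bool_inj.
apply: ptime_if; first by ptime_tac.
  apply: ptime_if; first by apply: ptime_has; [ptime_tac|apply: (ptime_eq inj); ptime_tac].
    by ptime_tac.
  apply: ptime_if; last by ptime_tac.
    by apply: ptime_or; [ptime_tac|apply: ptime_all; [ptime_tac|apply: (ptime_eq inj); ptime_tac]].
  by ptime_tac.
apply: (@ptime_ocase _ _ _ _ _ _ (fun a => nth None (v a) (head 0 (g a).2.2)) (fun _ => None)
  (fun _ b => Some (~~ b))); ptime_tac.
Qed.

Lemma sz_rcons X {cX : Code X} (s : seq X) x : sz (rcons s x) = (sz s + sz x).+1.
Proof. by elim: s => [|y s IH]; rewrite ?rcons_cons !sz_cons ?IH; [rewrite addnC|lia]. Qed.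

Lemma sz_option_bool (o : option bool) : sz o <= 5.
Proof. by case: o => [[]|]. Qed.

Lemma ptime_kleene_eval A {cA : Code A} (v : A -> seq (option bool)) (gs : A -> seq gcode) (out : A -> nat) :
  ptime v -> ptime gs -> ptime out -> ptime (fun a => kleene_eval (v a) (gs a) (out a)).
Proof.
move=> pv pg po; rewrite /kleene_eval; apply: ptime_nth => //.
(* A three-valued truth value has size at most 5, and its list cell adds 1. *)
apply: (@ptime_foldl_growth _ _ _ _ _ _ _ _ (fun _ g v => rcons v (kleene_gate v g)) (fun _ => 6)) => //.
- by apply: ptime_rcons; [ptime_tac|apply: ptime_kleene_gate; ptime_tac].
- exact: polyb_const.
- by move=> a g s _; rewrite sz_rcons; have := sz_option_bool (kleene_gate s g); lia.
Qed.

Lemma ptime_points A {cA : Code A} (s : A -> seq item) : ptime s -> ptime (fun a => points (s a)).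
Proof.
move=> ps; apply: (ptime_flatmap (h := fun _ (x : item) => [:: (x.1, x.2.1); (x.1.+1, x.2.2)])) => //.
ptime_tac.
Qed.

Lemma ptime_functional A {cA : Code A} (s : A -> seq (nat * nat)) :
  ptime s -> ptime (fun a => functional (s a)).
Proof.
move=> ps; rewrite /functional.
apply: ptime_all => //; apply: ptime_all; first by apply: (ptime_comp ps); ptime_tac.
by apply: ptime_imply; apply: (ptime_eq code_nat_inj); ptime_tac.
Qed.

Lemma ptime_items A {cA : Code A} (n k : A -> nat) : ptime n -> ptime k ->
  ptime (fun a => items (n a) (k a)).
Proof.
move=> pn pk; rewrite /items.
apply: (ptime_allpairs (h := fun _ i lr => (i, lr))); [ptime_tac| |ptime_tac].
by apply: (ptime_allpairs (h := fun _ l r => (l, r))); ptime_tac.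
Qed.

(** The number [q] is a constant outside the input: the program itself grows with [q], one product
    per level. *)
Lemma ptime_lists A X {cA : Code A} {cX : Code X} (q : nat) (s : A -> seq X) :
  ptime s -> ptime (fun a => lists q (s a)).
Proof.
move=> ps; elim: q => [|q IH] /=; first exact: ptime_const.
by apply: (ptime_allpairs (h := fun _ x l => x :: l)) => //; ptime_tac.
Qed.

Lemma ptime_view A {cA : Code A} (n : A -> nat) (s : A -> seq item) : ptime n -> ptime s ->
  ptime (fun a => view (n a) (s a)).
Proof.
move=> pn ps; apply: ptime_mkseq => //.
apply: (@ptime_lcase _ _ _ _ _ _
  (fun p : A * nat => [seq x <- s p.1 | (x.2.1 <= p.2) && (p.2 < x.2.2)]) (fun _ => None)
  (fun p x _ => Some (p.2.+1 == x.2.2))); [|ptime_tac|].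
  by apply: ptime_filter; [apply: (ptime_comp ps)|]; ptime_tac.
by apply: ptime_Some; apply: (ptime_eq code_nat_inj); ptime_tac.
Qed.

Lemma ptime_valid A {cA : Code A} (n k : A -> nat) (gs : A -> seq gcode) (out : A -> nat) (p : A -> label) :
  ptime n -> ptime k -> ptime gs -> ptime out -> ptime p ->
  ptime (fun a => valid (n a) (k a) (gs a) (out a) (p a)).
Proof.
move=> pn pk pg po pp; rewrite /valid; have pc : ptime (fun a => (p a).1 ++ (p a).2) by ptime_tac.
apply: ptime_and; [|apply: ptime_and].
- apply: ptime_functional; apply: ptime_cons; first by ptime_tac.
  by apply: ptime_cons; [ptime_tac|apply: ptime_points].
- by ptime_tac.
apply: (ptime_eq (code_option_inj code_bool_inj)); last by ptime_tac.
by apply: ptime_kleene_eval => //; apply: ptime_view.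
Qed.

Lemma ptime_vertices q A {cA : Code A} (n k : A -> nat) (gs : A -> seq gcode) (out : A -> nat) :
  ptime n -> ptime k -> ptime gs -> ptime out ->
  ptime (fun a => vertices q (n a) (k a) (gs a) (out a)).
Proof.
move=> pn pk pg po; rewrite /vertices.
have pl : ptime (fun a => lists q (items (n a) (k a))) by apply: ptime_lists; apply: ptime_items.
apply: (ptime_allpairs (h := fun _ c p => (c, p))); [exact: ptime_const| |ptime_tac].
apply: ptime_filter; first by apply: (ptime_allpairs (h := fun _ h v => (h, v))) => //; ptime_tac.
by apply: ptime_valid; [apply: (ptime_comp pn)|apply: (ptime_comp pk)|apply: (ptime_comp pg)
  |apply: (ptime_comp po)|]; ptime_tac.
Qed.

Definition code_item_seq_inj :=
  code_seq_inj (code_pair_inj code_nat_inj (code_pair_inj code_nat_inj code_nat_inj)).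
Definition code_vertex_inj :=
  code_pair_inj code_nat_inj (code_pair_inj code_item_seq_inj code_item_seq_inj).

Lemma ptime_adj A {cA : Code A} (u v : A -> nat * label) :
  ptime u -> ptime v -> ptime (fun a => adj (u a) (v a)).
Proof.
move=> pu pv; rewrite /adj /compatible.
apply: ptime_and; first by apply: ptime_neg; apply: (ptime_eq code_vertex_inj).
apply: ptime_and; first by apply: (ptime_eq code_item_seq_inj); ptime_tac.
by apply: ptime_functional; apply: ptime_points; ptime_tac.
Qed.

Lemma ptime_node_pairs A X {cA : Code A} {cX : Code X} (P : A -> seq X) :
  ptime P -> ptime (fun a => node_pairs (P a)).
Proof. by move=> pP; apply: (ptime_allpairs (h := fun _ p q => (p, q))) => //; ptime_tac. Qed.

Lemma ptime_nodes A X {cA : Code A} {cX : Code X} (P : A -> seq X) :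
  ptime P -> ptime (fun a => nodes (P a)).
Proof.
move=> pP; apply: ptime_cat; apply: ptime_map => //; try by ptime_tac.
exact: ptime_node_pairs.
Qed.

Lemma ptime_times A X {cA : Code A} {cX : Code X} (P : A -> seq X) :
  ptime P -> ptime (fun a => times (P a)).
Proof.
by move=> pP; apply: ptime_cat; apply: ptime_map; first [exact: ptime_node_pairs|ptime_tac].
Qed.

Lemma ptime_active A {cA : Code A} (x y t : A -> bool * ((nat * label) * (nat * label))) :
  ptime x -> ptime y -> ptime t -> ptime (fun a => active adj (x a) (y a) (t a)).
Proof.
move=> px py pt; rewrite /active /=.
have inj := code_pair_inj code_bool_inj (code_pair_inj code_vertex_inj code_vertex_inj).
have pe : ptime (fun a => (false, if (t a).1 then ((t a).2.2, (t a).2.2) else ((t a).2.1, (t a).2.1))).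
  by ptime_tac.
apply: ptime_and; first by apply: ptime_adj; ptime_tac.
by apply: ptime_or; apply: ptime_and; apply: (ptime_eq inj); ptime_tac.
Qed.

Lemma ptime_enc_nat A {cA : Code A} (n : A -> nat) : ptime n -> ptime (fun a => enc_nat (n a)).
Proof.
move=> pn; apply: ptime_rcons; last exact: ptime_const.
apply: (ptime_ext (f := fun a => [seq true | _ <- nseq (n a) tt])) => [|a].
  by apply: (ptime_map (h := fun _ _ => true)); [apply: ptime_nseq_unit|apply: ptime_const].
by rewrite map_nseq.
Qed.

Definition graph_word (P : seq (nat * label)) : word :=
  enc_nat (size (nodes P)) ++ enc_nat (size (times P)) ++
  flatten [seq has (active adj x y) (times P) :: [seq active adj x y t | t <- times P]
          | x <- nodes P, y <- nodes P].

Lemma ptime_graph_word : ptime graph_word.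
Proof.
have pn : ptime (fun P : seq (nat * label) => nodes P) by apply: ptime_nodes; ptime_tac.
have pt : ptime (fun P : seq (nat * label) => times P) by apply: ptime_times; ptime_tac.
rewrite /graph_word; apply: ptime_cat; first by apply: ptime_enc_nat; ptime_tac.
apply: ptime_cat; first by apply: ptime_enc_nat; ptime_tac.
pose h (P : seq (nat * label)) x y :=
  has (active adj x y) (times P) :: [seq active adj x y t | t <- times P].
apply: (ptime_ext (f := fun P => flatten [seq s | s <- [seq h P x y | x <- nodes P, y <- nodes P]])) => [|P].
  apply: (ptime_flatmap (h := fun _ s => s)); last by ptime_tac.
  apply: ptime_allpairs => //; rewrite /h; apply: ptime_cons.
    by apply: ptime_has; [apply: (ptime_comp pt)|apply: ptime_active]; ptime_tac.
  by apply: ptime_map; [apply: (ptime_comp pt)|apply: ptime_active]; ptime_tac.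
by rewrite map_id.
Qed.

Definition circuit_vertices (q : nat) (x : word * nat) : seq (nat * label) :=
  let C := read_circuit x.1 in vertices q C.1 x.2 C.2.1 C.2.2.

Definition reduction (q : nat) (x : word * nat) : word * nat :=
  (graph_word (circuit_vertices q x), 3 * x.2.+1 ^ q).

Lemma ptime_reduction q : ptime (reduction q).
Proof.
have pr : ptime (fun x : word * nat => read_circuit x.1).
  by apply: (ptime_comp ptime_read_circuit); ptime_tac.
rewrite /reduction; apply: ptime_pair.
  by apply: (ptime_comp ptime_graph_word); apply: ptime_vertices; ptime_tac.
by apply: ptime_mul; [ptime_tac|apply: ptime_exp; ptime_tac].
Qed.

Lemma reduction_correct d (C : circuit) (k : nat) :
  circuit_wf C -> weft C <= 1 -> depth C <= d ->
  exists G : tgraph_inst,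
    (reduction (2 ^ d) (enc_circuit C, k)).1 = enc_tgraph G /\
    (has_sat_of_weight C k <->
     exists X : {set 'I_(nvertices G)}, is_TCC (tg G) X /\
       (reduction (2 ^ d) (enc_circuit C, k)).2 <= #|X|).
Proof.
move=> wf w1 dd; set q := 2 ^ d.
have dq : 2 ^ depth C <= q by rewrite leq_exp2l.
pose P := vertices q (ninputs C) k (map code_gate (gates C)) (outnode C).
have uP : uniq P by apply: uniq_vertices.
exists (TGraphInst (arc_tgraph P adj)); split.
  rewrite enc_arc_tgraph /reduction /circuit_vertices [(enc_circuit C, k).1]/=.
  by rewrite read_circuitE.
rewrite /reduction /=; split=> [sat|[X [[cX _] leX]]].
  have [W [uW sW zW aW]] := clique_of_sat wf w1 dq sat.
  have [X tX leX] := TCC_of_clique uP adj_irr uW sW aW.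
  by exists X; rewrite -zW.
(* The target size is at least 3, which rules out a component consisting of one isolated vertex. *)
have X1 : 1 < #|X| by apply: leq_trans leX; have := expn_gt0 k.+1 q; lia.
have [W [uW sW leW aW]] := clique_of_connected uP adj_irr cX X1.
exact: (sat_of_clique wf w1 dq uW sW (leq_trans leX leW) aW).
Qed.

Theorem theorem5 : W_hard 1 TCC_problem.
Proof.
(* The new parameter is [3 * k.+1 ^ (2 ^ d)]; the exponent has two more units because
   [3 <= (k + 2) ^ 2]. *)
move=> L [d red]; apply: (fpt_reducible_ptime (e := 2 + 2 ^ d) red (ptime_reduction (2 ^ d))).
case=> [C /= hC] k; case/and3P: (hC) => wf w1 dd.
have [G [e iff]] := reduction_correct k wf w1 dd.
exists G; split=> //=.
rewrite expnD leq_mul //; first by rewrite addn2; nia.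
by case: (2 ^ d) => // q'; rewrite leq_exp2r //; lia.
Qed.
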